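(* Let $d\geq 2$, let $\mathbf{F}_d$ be the free group on $x_1,\dots,x_d$ with generating system $S=\{x_1^{\pm1},\dots,x_d^{\pm1}\}$, and let $\Lambda\leq\mathbf{F}_d$ be a finite index subgroup. Let $m_\Lambda$ be the Haar probability measure on $\mathrm{Iso}(\mathbf{F}_d)/\Lambda$. Then the following are equivalent. (i) The p.m.p. action $\mathrm{Iso}(\mathbf{F}_d)\curvearrowright(\mathrm{Iso}(\mathbf{F}_d)/\Lambda,m_\Lambda)$ is mixing. (ii) The p.m.p. action $\mathbf{F}_d\curvearrowright(\mathrm{Iso}(\mathbf{F}_d)/\Lambda,m_\Lambda)$ is mixing. (iii) $\Lambda$ is not contained in the even subgroup $\mathbf{F}_d^{ev}$.
   Context: The even subgroup $\mathbf{F}_d^{ev}$ is the index two normal subgroup of $\mathbf{F}_d$ consisting of the elements whose word length with respect to $S$ is even. $\mathrm{Iso}(\mathbf{F}_d)$ is the group of bijective isometries of the Cayley graph of $\mathbf{F}_d$ (vertex set $\mathbf{F}_d$, edges $\{\gamma,\gamma s\}$ with $s\in S$, graph distance), a locally compact second countable totally disconnected unimodular group for the topology of pointwise convergence, containing $\mathbf{F}_d$ as left translations. $\mathrm{Iso}(\mathbf{F}_d)/\Lambda$ denotes the quotient of $\mathrm{Iso}(\mathbf{F}_d)$ by the action of $\Lambda$ by postcomposition, $\lambda\cdot f:\gamma\mapsto\lambda f(\gamma)$; $\mathrm{Iso}(\mathbf{F}_d)$, hence $\mathbf{F}_d$, acts on it by precomposition by the inverse, $g[f]=[f\circ g^{-1}]$.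 The Haar probability measure $m_\Lambda$ is the image of the normalized restriction of the Haar measure of $\mathrm{Iso}(\mathbf{F}_d)$ to a measurable fundamental domain of $\Lambda$; it is the unique $\mathrm{Iso}(\mathbf{F}_d)$-invariant Borel probability measure. A p.m.p. action $G\curvearrowright(X,\mu)$ of a locally compact, non-compact, second countable group $G$ is mixing if for all measurable $A,B\subseteq X$ the function $g\mapsto|\mu(gA\cap B)-\mu(A)\mu(B)|$ vanishes at infinity, i.e. for all $\varepsilon>0$ the set of $g\in G$ where it is $\geq\varepsilon$ is compact. (For discrete $G$ this means finite.) *)

(* Defs.v *)
From HB Require Import structures.
From mathcomp Require Import all_boot all_order all_algebra.
From mathcomp Require Import all_classical all_reals all_analysis.

Set Implicit Arguments.
Unset Strict Implicit.
Unset Printing Implicit Defensive.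

Local Open Scope classical_set_scope.
Local Open Scope ring_scope.
Local Open Scope group_scope.
Local Open Scope quotient_scope.

(* The letter (i, false) is x_i and (i, true) is x_i^-1, for i < d. *)
Notation letter d := ('I_d * bool)%type.

Definition linv d (a : letter d) : letter d := (a.1, ~~ a.2).

Definition reduced d (w : seq (letter d)) : bool :=
  sorted (fun a b => b != linv a) w.

Record free_group (d : nat) :=
  FreeGroup { fg_word :> seq (letter d); _ : reduced fg_word }.
HB.instance Definition _ d := [isSub for @fg_word d].
HB.instance Definition _ d := [Countable of free_group d by <:].

Definition lcons d (a : letter d) (w : seq (letter d)) : seq (letter d) :=
  if w is b :: w' then if b == linv a then w' else a :: w else [:: a].

Section FreeGroupLaws.
Variable d : nat.
Implicit Types (a b : letter d) (u v w : seq (letter d)) (x y z : free_group d).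

Lemma linvK : involutive (@linv d).
Proof. by case=> i e; rewrite /linv /= negbK. Qed.

Lemma reduced_fg x : reduced x. Proof. by case: x. Qed.

Lemma reduced_behead a w : reduced (a :: w) -> reduced w.
Proof. by case: w => //= b w /andP[]. Qed.

Lemma reduced_lcons a w : reduced w -> reduced (lcons a w).
Proof.
case: w => //= b w; case: eqP => [_|/eqP nab] rw; first exact: reduced_behead rw.
by rewrite /reduced /= nab.
Qed.

Lemma reduced_foldr u v : reduced v -> reduced (foldr (@lcons d) v u).
Proof. by move=> rv; elim: u => //= a u; exact: reduced_lcons. Qed.

Lemma lconsK a w : reduced w -> lcons a (lcons (linv a) w) = w.
Proof.
case: w => [|b w] /=; first by rewrite eqxx.
rewrite linvK; case: eqP => [->|_ _] /=; last by rewrite eqxx.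
by case: w => [//|c w] /= /andP[/negbTE ->].
Qed.

Lemma lcons_reduced a w : reduced (a :: w) -> lcons a w = a :: w.
Proof. by case: w => //= b w /andP[/negbTE ->]. Qed.

Lemma foldr_lcons a u v : reduced v ->
  foldr (@lcons d) v (lcons a u) = lcons a (foldr (@lcons d) v u).
Proof.
case: u => [//|b u] rv /=; case: eqP => [->|//].
by rewrite lconsK //; exact: reduced_foldr.
Qed.

Lemma reduced_inv x : reduced (rev (map (@linv d) x)).
Proof.
rewrite /reduced rev_sorted sorted_map.
apply: sub_sorted (reduced_fg x) => a b /=.
by rewrite linvK eq_sym.
Qed.

Definition fg_one : free_group d := @FreeGroup d [::] isT.
Definition fg_mul x y : free_group d :=
  FreeGroup (reduced_foldr x (reduced_fg y)).
Definition fg_inv x : free_group d := FreeGroup (reduced_inv x).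

Lemma fg_mulA : associative fg_mul.
Proof.
move=> x y z; apply: val_inj => /=.
elim: (x : seq _) => //= a u ->.
by rewrite foldr_lcons //; exact: reduced_fg.
Qed.

Lemma fg_mul1 : left_id fg_one fg_mul.
Proof. by move=> x; apply: val_inj. Qed.

Lemma fg_mulr1 : right_id fg_one fg_mul.
Proof.
move=> x; apply: val_inj => /=.
elim: (x : seq _) (reduced_fg x) => //= a u IH rau.
by rewrite IH ?(reduced_behead rau) // lcons_reduced.
Qed.

Lemma fg_mulV : left_inverse fg_one fg_inv fg_mul.
Proof.
move=> x; apply: val_inj => /=.
have: reduced x by exact: reduced_fg.
elim: (x : seq _) => //= a u IH rau; have ru := reduced_behead rau.
rewrite rev_cons -cats1 foldr_cat /=.
by rewrite linvK eqxx IH.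
Qed.

Lemma fg_mulrV : right_inverse fg_one fg_inv fg_mul.
Proof.
move=> x; rewrite -[RHS](fg_mulV (fg_inv x)); congr fg_mul.
by apply: val_inj; rewrite /= -map_rev revK -map_comp (eq_map linvK) map_id.
Qed.

HB.instance Definition _ := @isGroup.Build (free_group d)
  fg_one fg_inv fg_mul fg_mulA fg_mul1 fg_mulr1 fg_mulV fg_mulrV.

End FreeGroupLaws.

HB.instance Definition _ d := isPointed.Build (free_group d) 1.
HB.instance Definition _ d := hasNbhs.Build (free_group d) principal_filter.
HB.instance Definition _ d := Discrete_ofNbhs.Build (free_group d) erefl.

Lemma reduced1 d (a : letter d) : reduced [:: a]. Proof. by []. Qed.

Definition gen d (a : letter d) : free_group d := FreeGroup (reduced1 a).

Lemma gen_inv d (a : letter d) : (gen a)^-1 = gen (linv a).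
Proof. by apply: val_inj. Qed.

Definition is_word_of d (x : free_group d) (n : nat) : bool :=
  [exists w : n.-tuple (letter d), x == \prod_(a <- w) gen a].

Lemma prod_gen d (x : free_group d) : \prod_(a <- val x) gen a = x.
Proof.
apply: val_inj; have: reduced (val x) by exact: reduced_fg.
elim: (val x) => [|a u IH] rau; first by rewrite big_nil.
rewrite big_cons -[LHS]/(lcons a (val (\prod_(b <- u) gen b))).
by rewrite (IH (reduced_behead rau)) lcons_reduced.
Qed.

Lemma is_word_of_ex d (x : free_group d) : exists n, is_word_of x n.
Proof.
by exists (size (val x)); apply/existsP; exists (in_tuple (val x)); rewrite prod_gen.
Qed.

Definition word_length d (x : free_group d) : nat := ex_minn (is_word_of_ex x).

Definition even_subgroup (d : nat) : {pred free_group d} :=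
  [pred x | ~~ odd (word_length x)].
Arguments even_subgroup d : clear implicits.

Definition cayley_adj d (x y : free_group d) : bool :=
  [exists a : letter d, y == x * gen a].

Definition walk d (x y : free_group d) (n : nat) : bool :=
  `[< exists p, [/\ size p = n, path (@cayley_adj d) x p & last x p = y] >].

Lemma walk_ex d (x y : free_group d) : exists n, walk x y n.
Proof.
suff [p pP pl] : exists2 p, path (@cayley_adj d) x p & last x p = y.
  by exists (size p); apply/asboolP; exists p.
rewrite -[y](mulVKg x) -[x^-1 * y]prod_gen.
move: (val (x^-1 * y)) => w; elim: w x => [|a u IH] z.
  by exists [::]; rewrite // big_nil mulg1.
have [p pP pl] := IH (z * gen a); exists (z * gen a :: p) => /=.
  by rewrite pP andbT; apply/existsP; exists a.
by rewrite pl big_cons mulgA.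
Qed.

Definition cayley_dist d (x y : free_group d) : nat := ex_minn (walk_ex x y).

Lemma cayley_distM d (g x y : free_group d) :
  cayley_dist (g * x) (g * y) = cayley_dist x y.
Proof.
have shift (h u v : free_group d) n : walk u v n -> walk (h * u) (h * v) n.
  move=> /asboolP[p [sp pp lp]]; apply/asboolP.
  exists [seq h * s | s <- p]; split; first by rewrite size_map.
    rewrite path_map; apply: sub_path pp => s t /existsP[a /eqP ->].
    by apply/existsP; exists a; rewrite mulgA.
  by rewrite last_map lp.
apply: eq_ex_minn => n; apply/idP/idP; last exact: shift.
by move=> /(shift g^-1 (g * x) (g * y)); rewrite !mulKg.
Qed.

Definition iso_set (d : nat) : set {ptws free_group d -> free_group d} :=
  [set f | bijective f /\
           forall x y, cayley_dist (f x) (f y) = cayley_dist x y].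

Definition iso (d : nat) : Type := set_type (@iso_set d).

(* As a subset of {ptws _ -> _}, with F_d discrete, iso d carries the topology
   of pointwise convergence. *)
HB.instance Definition _ d := SubType.copy (iso d) (set_type (@iso_set d)).
HB.instance Definition _ d := Topological.copy (iso d) (set_type (@iso_set d)).

Section IsoGroup.
Variable d : nat.
Implicit Types f g h : iso d.

Definition iso_fun f : free_group d -> free_group d := set_val f.

Lemma iso_funP f : iso_set (iso_fun f).
Proof. by have := set_valP f. Qed.

Lemma iso_ext f g : iso_fun f =1 iso_fun g -> f = g.
Proof. by move=> fg; apply: val_inj; apply/funext. Qed.

Definition mk_iso (f : free_group d -> free_group d) (fP : iso_set f) : iso d :=
  SigSub (mem_set fP).

Lemma iso_one_subproof : iso_set (@idfun (free_group d)).
Proof. by split=> //; exists idfun. Qed.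

Lemma iso_mul_subproof f g : iso_set (iso_fun f \o iso_fun g).
Proof.
have [[bf df] [bg dg]] := (iso_funP f, iso_funP g).
by split; [exact: bij_comp | move=> x y /=; rewrite df dg].
Qed.

Definition inv_fun f (y : free_group d) : free_group d :=
  xget 1 [set x | iso_fun f x = y].

Lemma inv_funK f : cancel (inv_fun f) (iso_fun f).
Proof.
move=> y; have [[g fK gK] _] := iso_funP f.
by rewrite /inv_fun; case: xgetP => [x _ //|/(_ (g y))/=]; rewrite gK.
Qed.

Lemma fun_invK f : cancel (iso_fun f) (inv_fun f).
Proof.
move=> x; have [[g fK gK] _] := iso_funP f.
by apply: (can_inj fK); rewrite inv_funK.
Qed.

Lemma iso_inv_subproof f : iso_set (inv_fun f).
Proof.
have [_ df] := iso_funP f; split; first by exists (iso_fun f); [exact: inv_funK|exact: fun_invK].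
by move=> x y; rewrite -df !inv_funK.
Qed.

Definition iso_one := mk_iso iso_one_subproof.
Definition iso_mul f g := mk_iso (iso_mul_subproof f g).
Definition iso_inv f := mk_iso (iso_inv_subproof f).

Lemma iso_mulA : associative iso_mul.
Proof. by move=> f g h; exact: iso_ext. Qed.
Lemma iso_mul1 : left_id iso_one iso_mul.
Proof. by move=> f; exact: iso_ext. Qed.
Lemma iso_mulr1 : right_id iso_one iso_mul.
Proof. by move=> f; exact: iso_ext. Qed.
Lemma iso_mulV : left_inverse iso_one iso_inv iso_mul.
Proof. by move=> f; apply: iso_ext => x; exact: fun_invK. Qed.
Lemma iso_mulrV : right_inverse iso_one iso_inv iso_mul.
Proof. by move=> f; apply: iso_ext => x; exact: inv_funK. Qed.

HB.instance Definition _ := @isGroup.Build (iso d)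
  iso_one iso_inv iso_mul iso_mulA iso_mul1 iso_mulr1 iso_mulV iso_mulrV.

HB.instance Definition _ := isPointed.Build (iso d) 1.

Lemma transl_subproof (x : free_group d) : iso_set (fun y => x * y).
Proof.
by split; [exists (fun y => x^-1 * y); [exact: mulKg|exact: mulVKg]|exact: cayley_distM].
Qed.

Definition transl (x : free_group d) : iso d := mk_iso (transl_subproof x).

Lemma translM x y : transl (x * y) = transl x * transl y.
Proof. by apply: iso_ext => z; exact: esym (mulgA x y z). Qed.

Lemma transl1 : transl 1 = 1.
Proof. by apply: iso_ext => z; exact: mul1g. Qed.

End IsoGroup.

Section Quotient.
Variables (d : nat) (L : groupClosed (free_group d)).

Definition finite_index : Prop :=
  finite_set (range (fun x : free_group d => [set x * l | l in [set` L]])).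

Definition orbit_rel (f g : iso d) : bool :=
  `[< exists2 l, l \in L & g = transl l * f >].

Lemma orbit_refl : reflexive orbit_rel.
Proof. by move=> f; apply/asboolP; exists 1; rewrite ?gpred1 // transl1 mul1g. Qed.

Lemma orbit_sym : symmetric orbit_rel.
Proof.
have sub f g : orbit_rel f g -> orbit_rel g f.
  move=> /asboolP[l Ll ->]; apply/asboolP; exists l^-1; first by rewrite gpredV.
  by rewrite mulgA -translM mulVg transl1 mul1g.
by move=> f g; apply/idP/idP; exact: sub.
Qed.

Lemma orbit_trans : transitive orbit_rel.
Proof.
move=> g f h /asboolP[l Ll ->] /asboolP[m Lm ->]; apply/asboolP.
by exists (m * l); rewrite ?gpredM // translM mulgA.
Qed.

Canonical orbit_equiv := EquivRel orbit_rel orbit_refl orbit_sym orbit_trans.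

Definition iso_quot : Type := quotient_topology {eq_quot orbit_equiv}.
HB.instance Definition _ := PointedTopological.on iso_quot.

Definition iso_pi (f : iso d) : iso_quot := \pi_{eq_quot orbit_equiv} f.

Definition iso_act (g : iso d) (q : iso_quot) : iso_quot :=
  iso_pi (repr (q : {eq_quot orbit_equiv}) * g^-1).

Lemma iso_actE g f : iso_act g (iso_pi f) = iso_pi (f * g^-1).
Proof.
rewrite /iso_act /iso_pi; apply/eqmodP => /=.
have /eqmodP /asboolP[l Ll {2}->] :
  repr (\pi_{eq_quot orbit_equiv} f) = f %[mod {eq_quot orbit_equiv}].
  by rewrite reprK.
by apply/asboolP; exists l; rewrite ?mulgA.
Qed.

Lemma iso_act1 q : iso_act 1 q = q.
Proof. by rewrite /iso_act /iso_pi invg1 mulg1 reprK. Qed.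

Lemma iso_actM g h q : iso_act (g * h) q = iso_act g (iso_act h q).
Proof. by rewrite {3}/iso_act iso_actE /iso_act invgM mulgA. Qed.

Definition fg_act (x : free_group d) : iso_quot -> iso_quot := iso_act (transl x).

End Quotient.

Notation borel T := (g_sigma_algebraType (@open T)).

Section Haar.
Variables (d : nat) (R : realType).

(* iso d being second countable, no separate regularity condition is needed. *)
Definition haar_measure (eta : {measure set (borel (iso d)) -> \bar R}) : Prop :=
  [/\ forall K : set (iso d), compact K -> (eta K < +oo)%E,
      eta setT <> 0%E
    & forall (g : iso d) (A : set (borel (iso d))), measurable A ->
        eta [set g * f | f in A] = eta A].

Variable L : groupClosed (free_group d).

Definition fundamental_domain (D : set (iso d)) : Prop :=
  forall f, exists! f', D f' /\ orbit_rel L f f'.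

Definition borel_pi : borel (iso d) -> borel (iso_quot L) := @iso_pi d L.

Lemma measurable_borel_pi : measurable_fun setT borel_pi.
Proof.
apply: (@measurability _ _ (borel (iso d)) (borel (iso_quot L)) _ _ _ _) => //.
move=> _ [U oU <-]; rewrite setTI.
exact: sub_gen_smallest.
Qed.

HB.instance Definition _ :=
  isMeasurableFun.Build _ _ _ _ borel_pi measurable_borel_pi.

(* The fallback point of mnormalize is only used if eta D is 0 or +oo, which
   does not happen for a Haar measure, L of finite index and D a fundamental
   domain. *)
Definition haar_prob (eta : {measure set (borel (iso d)) -> \bar R})
    (D : set (borel (iso d))) (mD : measurable D) :
    probability (borel (iso_quot L)) R :=
  distribution (mnormalize (mrestr eta mD) point) borel_pi.

End Haar.

(* For a discrete group G, compact means finite. *)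
Definition mixing disp (G : topologicalType) (X : measurableType disp)
    (R : realType) (act : G -> X -> X) (mu : probability X R) : Prop :=
  forall A B : set X, measurable A -> measurable B ->
  forall eps : R, (0 < eps)%R ->
    compact [set g : G |
      (eps%:E <= `|mu ((act g @` A) `&` B) - mu A * mu B|)%E].

(* Main.v *)
Require Import Defs.
From HB Require Import structures.
From mathcomp Require Import all_boot all_order all_algebra.
From mathcomp Require Import all_classical all_reals all_analysis.
From mathcomp Require Import zify lra.

(** Let [G = iso d] be the isometry group of the [2 * d]-regular tree. If [L] lies in the
    even subgroup, the parity of the length of [f 1] is well defined on the quotient;
    it cuts the quotient into two halves that every even element of the free group
    preserves, so the free group does not mix. Mixing of [G] passes to the
    free group because only finitely many translations lie in a compact set. The
    substance is that [G] mixes as soon as [L] has an element of odd length.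

    A point of the quotient is a locally bijective map from the tree to the
    finite graph of cosets of [L], and it is read along a geodesic as a
    non-backtracking walk on that graph. Three facts make this precise.
    - [edge_indep]: once the image of a directed edge is fixed, what an isometry does
      behind the edge is independent of what it does ahead of it. This rests on
      [glue_iso]: isometries that fix an edge can be modified on one side only.
    - [cond_step]: the continuations of a geodesic are equally likely, so
      conditional probabilities of events far ahead are obtained by iterating
      the averaging operator [avg] of the walk.
    - [avg_mixing]: these iterates converge to constants. By [reach_setT] every
      directed edge reaches all of them in a common number of steps (here the odd
      element of [L] enters, through [even_trans]), and Doeblin's argument applies.

    Together they give [decorrelation]: an event about the restriction of [f] to a
    ball around [1] and one about a ball around [v] become independent as [v] goes
    to infinity. The event [g A] concerns a ball around [g 1] when [A] concerns a ball
    around [1], so this is mixing for cylinders. It extends to all Borel sets by a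
    Dynkin argument ([dominated_set_cvg]), which needs the invariance of the
    probability of the quotient under [G].

    That invariance ([haar_prob_act]) is a statement about right translations, whereas
    the Haar measure [eta] is only known to be left invariant. It comes from counting:
    left invariance alone determines the mass of cylinders up to a constant
    ([left_invariant_ratio]), hence right translations rescale [eta] on [L]-invariant
    sets, and the scaling factor is [1] since the total mass of a
    fundamental domain is finite and does not depend on the domain ([fundamental_eq]). *)

Set Implicit Arguments.
Unset Strict Implicit.
Unset Printing Implicit Defensive.
Import Order.TTheory GRing.Theory Num.Theory.
Import numFieldNormedType.Exports.

Local Open Scope classical_set_scope.
Local Open Scope ring_scope.

Local Notation len x := (size (val x%g)).

(** * Lengths and edges in the Cayley tree *)

Section Words.
Local Open Scope group_scope.
Variable d : nat.
Implicit Types (a b : letter d) (u v w : seq (letter d)) (x y z : free_group d).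

Lemma linv_neq a : linv a != a.
Proof. by case: a => i e; rewrite /linv xpair_eqE eqxx /=; case: e. Qed.

Lemma val_mul x y : val (x * y) = foldr (@lcons d) (val y) (val x).
Proof. by []. Qed.

Lemma val_inv x : val x^-1 = rev (map (@linv d) (val x)).
Proof. by []. Qed.

Lemma val_genM a x : val (gen a * x) = lcons a (val x).
Proof. by []. Qed.

Lemma genVK a x : gen a * (gen (linv a) * x) = x.
Proof. by rewrite -gen_inv mulVKg. Qed.

Lemma size_inv x : len x^-1 = len x.
Proof. by rewrite val_inv size_rev size_map. Qed.

Lemma size_invM x y : len (x^-1 * y) = len (y^-1 * x).
Proof. by rewrite -size_inv invgM invgK. Qed.

Lemma ohead_lcons a w : reduced w ->
  if ohead w == Some (linv a) then w = linv a :: lcons a w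
  else lcons a w = a :: w.
Proof.
case: w => [//|b w] _ /=; rewrite [Some b == _](_ : _ = (b == linv a)) //.
by case: eqP => // ->.
Qed.

Lemma size_lcons a w : reduced w ->
  size (lcons a w) = (if ohead w == Some (linv a) then (size w).-1 else (size w).+1).
Proof. by move=> /(@ohead_lcons a); case: ifP => [_ {2}->|_ ->]. Qed.

Lemma size_mul_le x y : (len (x * y) <= len x + len y)%N.
Proof.
rewrite val_mul; elim: (val x) => //= a u IH.
rewrite size_lcons; last by apply: reduced_foldr; exact: reduced_fg.
rewrite addSn; case: ifP => _; last by rewrite ltnS.
by apply: leq_trans (leq_pred _) _; exact: leqW.
Qed.

(** Each cancellation removes two letters. *)
Lemma odd_size_mul x y :
  odd (len (x * y)) = odd (len x) (+) odd (len y).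
Proof.
rewrite val_mul; elim: (val x) => //= a u IH.
set w := foldr _ _ _; have rw : reduced w by apply: reduced_foldr; exact: reduced_fg.
have := @ohead_lcons a w rw; case: ifP => _.
  move=> E; have : odd (size w) = ~~ odd (size (lcons a w)) by rewrite {1}E.
  by rewrite IH addNb => ->; rewrite negbK.
by move=> ->; rewrite /= IH addNb.
Qed.

Lemma cayley_adjE x y : cayley_adj x y = (len (x^-1 * y) == 1%N).
Proof.
apply/existsP/eqP => [[a /eqP ->]|]; first by rewrite mulKg.
case E : (val (x^-1 * y)) => [//|a [|//]] _; exists a.
by apply/eqP; rewrite -[LHS](mulVKg x); congr (_ * _); apply: val_inj.
Qed.

Lemma cayley_distE x y : cayley_dist x y = len (x^-1 * y).
Proof.
rewrite /cayley_dist; case: ex_minnP => m /asboolP[p [sp pp lp]] mmin.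
apply/eqP; rewrite eqn_leq; apply/andP; split; last first.
  rewrite -sp -lp {mmin sp lp}; elim: p x pp => [x _|z p IH x /=].
    by rewrite -[last _ _]/x mulVg.
  rewrite cayley_adjE => /andP[/eqP xz /IH zp].
  have := size_mul_le (x^-1 * z) (z^-1 * last z p).
  by rewrite mulgA mulgK xz add1n => /leq_trans -> //.
suff walkP w z : exists p, [/\ size p = size w, path (@cayley_adj d) z p
    & last z p = z * \prod_(a <- w) gen a].
  apply: mmin; apply/asboolP.
  by have := walkP (val (x^-1 * y)) x; rewrite prod_gen mulVKg.
elim: w z => [|a u IH] z; first by exists [::]; split => //; rewrite big_nil mulg1.
have [q [sq pP pl]] := IH (z * gen a); exists (z * gen a :: q); split => /=.
- by rewrite sq.
- by rewrite pP andbT; apply/existsP; exists a.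
- by rewrite pl big_cons mulgA.
Qed.

Lemma word_lengthE x : word_length x = len x.
Proof.
rewrite /word_length; case: ex_minnP => m /existsP[w /eqP xw] mmin.
apply/eqP; rewrite eqn_leq mmin /=; last first.
  by apply/existsP; exists (in_tuple (val x)); rewrite prod_gen.
rewrite -(size_tuple w) xw; elim: (tval w) => [|a u IH].
  by rewrite big_nil.
rewrite big_cons; apply: leq_trans (size_mul_le _ _) _.
by rewrite add1n ltnS.
Qed.

Lemma even_subgroupE x : (x \in even_subgroup d) = ~~ odd (len x).
Proof. by rewrite inE word_lengthE. Qed.

Lemma finite_ball n : finite_set [set x : free_group d | (len x <= n)%N].
Proof.
elim: n => [|n IH].
  apply: (sub_finite_set _ (finite_set1 (1 : free_group d))) => x /=.
  by rewrite leqn0 size_eq0 => /eqP x1; apply: val_inj.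
pose B := [set x : free_group d | (len x <= n)%N].
apply: (@sub_finite_set _ _ ([set 1] `|` \bigcup_(a in [set: letter d]) (fun x => gen a * x) @` B)).
  move=> x /=; case E : (val x) => [|a u] su.
    by left; apply: val_inj.
  right; exists a => //; exists (gen (linv a) * x); last by rewrite genVK.
  by rewrite /B /mkset val_genM E /= linvK eqxx.
rewrite finite_setU; split; first exact: finite_set1.
by apply: bigcup_finite => [|a _]; [exact: finite_finset|exact: finite_image].
Qed.

(** Removing the edge between [y] and [y * gen a] leaves two half-trees; the vertices
    ahead are those on the side of [y * gen a]. Comparing distances to the two ends makes
    the notion visibly equivariant under isometries. *)
Definition ahead y a x : bool :=
  (len ((y * gen a)^-1 * x) < len (y^-1 * x))%N.

Lemma aheadE y a x : ahead y a x = (ohead (val (y^-1 * x)) == Some a).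
Proof.
rewrite /ahead invgM -mulgA gen_inv val_genM size_lcons ?linvK; last exact: reduced_fg.
by case: (val _) => [|b w] //=; case: ifP => _; rewrite ?ltnSn // ltnNge leqnSn.
Qed.

Lemma size_ahead_step y a x : ahead y a x ->
  len (y^-1 * x) = (len ((y * gen a)^-1 * x)).+1.
Proof.
rewrite aheadE => h; rewrite invgM -mulgA gen_inv val_genM.
rewrite size_lcons ?linvK; last exact: reduced_fg.
by rewrite h; move: h; case: (val (y^-1 * x)).
Qed.

Lemma size_foldr_heads a u v : reduced u -> ohead v = Some a -> ohead u <> Some a ->
  size (foldr (@lcons d) v (rev (map (@linv d) u))) = (size u + size v)%N.
Proof.
elim: u a v => [//|b u IH] a [//|_ v] rbu [->] nba.
rewrite map_cons rev_cons -cats1 foldr_cat /= linvK.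
case: eqP => [ab|_]; first by case: nba; rewrite ab.
rewrite (IH (linv b)) //=; first by rewrite addnS.
  exact: reduced_behead rbu.
by case: u rbu {IH nba} => //= c u /andP[+ _] [cb]; rewrite cb eqxx.
Qed.

(** Geodesics between the two half-trees pass through the edge that separates them: the
    word of [z^-1 * x] is a concatenation in which nothing cancels. *)
Lemma size_across y a x z : ahead y a x -> ~~ ahead y a z ->
  len (z^-1 * x) = (len (z^-1 * y) + len (y^-1 * x))%N.
Proof.
rewrite !aheadE => /eqP hx /eqP hz.
have -> : z^-1 * x = (y^-1 * z)^-1 * (y^-1 * x) by rewrite invgM invgK mulgA mulgK.
by rewrite val_mul val_inv (size_foldr_heads _ hx hz) 1?size_invM //; exact: reduced_fg.
Qed.

Lemma take_reduced n w : reduced w -> reduced (take n w).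
Proof. exact: take_sorted. Qed.

Definition prefix_fg n x : free_group d := FreeGroup (take_reduced n (reduced_fg x)).

Lemma size_prefix n x : (n <= len x)%N -> len (prefix_fg n x) = n.
Proof. by move=> h; rewrite size_takel. Qed.

Lemma prefixV n x : val ((prefix_fg n x)^-1 * x) = drop n (val x).
Proof.
have rd : reduced (drop n (val x)) by apply: drop_sorted; exact: reduced_fg.
have xE : x = prefix_fg n x * FreeGroup rd.
  rewrite -[LHS]prod_gen -{1}(cat_take_drop n (val x)) big_cat.
  by congr (_ * _); [exact: (prod_gen (prefix_fg n x))|exact: (prod_gen (FreeGroup rd))].
by rewrite {2}xE mulKg.
Qed.

Definition letter_at a0 n x : letter d := nth a0 (val x) n.

Lemma prefixS a0 n x : (n < len x)%N ->
  prefix_fg n.+1 x = prefix_fg n x * gen (letter_at a0 n x).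
Proof.
move=> nx; rewrite -[LHS]prod_gen /= (take_nth a0) // -cats1 big_cat big_seq1 /=.
by rewrite -[take n _]/(val (prefix_fg n x)) prod_gen.
Qed.

Lemma letter_at_red a0 n x : (n.+1 < len x)%N ->
  letter_at a0 n.+1 x != linv (letter_at a0 n x).
Proof. by move=> nx; have /(sortedP a0) /(_ n nx) := reduced_fg x. Qed.

(** These two lemmas place the balls around [1] and around [x] on the two sides of an
    edge of the geodesic from [1] to [x]. The letter [a0] is a default value. *)
Lemma ahead_prefix a0 n x z : (n < len x)%N ->
  (len (z^-1 * x) < len x - n)%N ->
  ahead (prefix_fg n x) (letter_at a0 n x) z.
Proof.
move=> nx zx; apply: contraTT zx => hz; rewrite -leqNgt.
have hx : ahead (prefix_fg n x) (letter_at a0 n x) x.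
  rewrite aheadE prefixV; apply/eqP.
  by rewrite (drop_nth a0) //.
by rewrite (size_across hx hz) prefixV size_drop leq_addl.
Qed.

Lemma behind_prefix a0 n x z : (n < len x)%N -> (len z <= n)%N ->
  ~~ ahead (prefix_fg n x) (letter_at a0 n x) z.
Proof.
move=> nx; apply: contraTN => hz; rewrite -ltnNge.
have h1 : ~~ ahead (prefix_fg n x) (letter_at a0 n x) 1.
  rewrite /ahead -prefixS // !mulg1 !size_inv !size_prefix //; last exact: ltnW.
  by rewrite -leqNgt.
have := size_across hz h1; rewrite invg1 !mul1g => ->.
by rewrite (size_prefix (ltnW nx)) (size_ahead_step hz) addnS ltnS leq_addr.
Qed.

End Words.

(** * Construction of isometries of the tree *)

Section Isometries.
Local Open Scope group_scope.
Variable d : nat.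
Implicit Types (a b c : letter d) (x y z : free_group d) (f g k : iso d).

Lemma iso_len f x y : len ((iso_fun f x)^-1 * iso_fun f y) = len (x^-1 * y).
Proof. by have [_ df] := iso_funP f; rewrite -!cayley_distE df. Qed.

Lemma iso_inj f : injective (iso_fun f).
Proof. exact: can_inj (fun_invK f). Qed.

Lemma iso_funM f g x : iso_fun (f * g) x = iso_fun f (iso_fun g x).
Proof. by []. Qed.

Lemma iso_funV f x : iso_fun f^-1 (iso_fun f x) = x.
Proof. exact: fun_invK. Qed.

Lemma iso_funVK f x : iso_fun f (iso_fun f^-1 x) = x.
Proof. by rewrite -[RHS]/(iso_fun 1 x) -(mulgV f). Qed.

Lemma iso_transl y x : iso_fun (transl y) x = y * x.
Proof. by []. Qed.

Lemma iso_adj f y a : exists b, iso_fun f (y * gen a) = iso_fun f y * gen b.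
Proof.
have : cayley_adj (iso_fun f y) (iso_fun f (y * gen a)).
  by rewrite cayley_adjE iso_len mulKg.
by move=> /existsP[b /eqP ->]; exists b.
Qed.

Lemma ahead_iso f y a y' a' x : iso_fun f y = y' -> iso_fun f (y * gen a) = y' * gen a' ->
  ahead y' a' (iso_fun f x) = ahead y a x.
Proof. by rewrite /ahead => <- <-; rewrite !iso_len. Qed.

Definition glue_fun k y a x := if ahead y a x then iso_fun k x else x.

(** Tits' independence property: an isometry that fixes an edge preserves both
    half-trees, and only the distance to the edge matters between them, so it may be
    replaced by the identity on one side. *)
Lemma glue_subproof k y a : iso_fun k y = y -> iso_fun k (y * gen a) = y * gen a ->
  iso_set (glue_fun k y a).
Proof.
move=> ky kya; have kV z : iso_fun k z = z -> iso_fun k^-1 z = z.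
  by move=> {1}<-; rewrite iso_funV.
have ah x := ahead_iso x ky kya.
have ahV x := ahead_iso x (kV _ ky) (kV _ kya).
split.
  exists (glue_fun k^-1 y a) => x; rewrite [glue_fun _ _ _ x in LHS]/glue_fun.
    by case: ifP => hx; rewrite /glue_fun ?ah hx // iso_funV.
  by case: ifP => hx; rewrite /glue_fun ?ahV hx // iso_funVK.
have across x z : ahead y a x -> ~~ ahead y a z ->
    len (z^-1 * iso_fun k x) = len (z^-1 * x).
  move=> hx hz; rewrite (size_across hx hz) (size_across _ hz) ?ah //.
  by rewrite -{2}ky iso_len.
move=> x z; rewrite !cayley_distE /glue_fun.
have [hx|hx] := boolP (ahead y a x); have [hz|hz] := boolP (ahead y a z) => //.
- by rewrite iso_len.
- by rewrite ![len (_ * z)]size_invM across.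
- by rewrite across.
Qed.

Definition glue_iso k y a ky kya : iso d := mk_iso (@glue_subproof k y a ky kya).

(** The involution of the letters that exchanges [b] and [c] and commutes with [linv];
    when [c = linv b] it inverts one generator. *)
Definition swapl b c a : letter d :=
  if a == b then c else if a == c then b else
  if a == linv b then linv c else if a == linv c then linv b else a.

Lemma swapl_linv b c a : swapl b c (linv a) = linv (swapl b c a).
Proof.
have lE u v : (linv u == v) = (u == linv v).
  by apply: inv_eq; exact: linvK.
rewrite /swapl !lE !linvK.
have nb : b == linv b = false by rewrite eq_sym (negbTE (linv_neq b)).
have nc : c == linv c = false by rewrite eq_sym (negbTE (linv_neq c)).
case: (a =P b) => [->|_]; first by rewrite nb; case: eqP.
case: (a =P c) => [->|_]; first by rewrite nc; case: eqP.
by do 2![case: eqP => [_|_]; rewrite ?linvK //].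
Qed.

Lemma swaplK b c : involutive (swapl b c).
Proof.
move=> a; rewrite [swapl b c a]/swapl.
have nb : linv b == b = false by exact: negbTE (linv_neq b).
have nc : linv c == c = false by exact: negbTE (linv_neq c).
case: (a =P b) => [->|/eqP ab]; first by rewrite /swapl eqxx; case: eqP.
case: (a =P c) => [->|/eqP ac]; first by rewrite /swapl eqxx.
case: (a =P linv b) => [aE|/eqP ab'].
  rewrite /swapl nc (inv_eq (@linvK d)) [c == linv b]eq_sym -aE (negbTE ac) eqxx.
  by case: eqP.
case: (a =P linv c) => [aE|/eqP ac'].
  by rewrite /swapl nb eqxx (inv_eq (@linvK d)) -aE; case: eqP => // ->.
by rewrite /swapl (negbTE ab) (negbTE ac) (negbTE ab') (negbTE ac').
Qed.

Lemma swapl_inj b c : injective (swapl b c).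
Proof. exact: inv_inj (@swaplK b c). Qed.

Lemma reduced_swap b c x : reduced (map (swapl b c) (val x)).
Proof.
rewrite /reduced sorted_map; apply: sub_sorted (reduced_fg x) => u v /=.
by rewrite -swapl_linv (inj_eq (@swapl_inj b c)).
Qed.

Definition swapw b c x : free_group d := FreeGroup (reduced_swap b c x).

Lemma swapwK b c : involutive (swapw b c).
Proof.
by move=> x; apply: val_inj; rewrite /= -map_comp map_id_in // => u _ /=; exact: swaplK.
Qed.

Lemma lcons_map b c a w : lcons (swapl b c a) (map (swapl b c) w) = map (swapl b c) (lcons a w).
Proof.
case: w => [//|e w] /=; rewrite -swapl_linv (inj_eq (@swapl_inj b c)).
by case: ifP.
Qed.

Lemma swapwM b c x y : swapw b c (x * y) = swapw b c x * swapw b c y.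
Proof.
apply: val_inj => /=; elim: (fg_word x) => //= a u <-.
by rewrite lcons_map.
Qed.

Lemma swapwV b c x : swapw b c x^-1 = (swapw b c x)^-1.
Proof.
have sw1 : swapw b c 1 = 1 by apply: val_inj.
by apply: esym; apply: mulg1_eq; rewrite -swapwM mulgV.
Qed.

Lemma len_swapw b c x : len (swapw b c x) = len x.
Proof. exact: size_map. Qed.

Definition swap_dom b c x := (ohead (val x) == Some b) || (ohead (val x) == Some c).
Definition swap_fun b c x := if swap_dom b c x then swapw b c x else x.

Lemma swap_dom_swapw b c x : swap_dom b c (swapw b c x) = swap_dom b c x.
Proof.
rewrite /swap_dom /=; case: (val x) => [//|e w] /=.
have E u v : (Some u == Some v :> option (letter d)) = (u == v) by [].
rewrite !E !(inv_eq (@swaplK b c)) orbC; congr (_ || _); congr (_ == _).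
  by rewrite /swapl eqxx; case: eqP.
by rewrite /swapl eqxx.
Qed.

(** A signed permutation of the generators that moves a letter moves its inverse too.
    Applying it only on the two branches that it exchanges gives an isometry that
    fixes all the other neighbours of [1]. *)
Lemma swap_subproof b c : iso_set (swap_fun b c).
Proof.
have swapK : involutive (swap_fun b c).
  move=> x; rewrite [swap_fun b c x]/swap_fun; case: ifP => hx.
    by rewrite /swap_fun swap_dom_swapw hx swapwK.
  by rewrite /swap_fun hx.
split; first by exists (swap_fun b c).
have ah a x : ahead 1 a x = (ohead (val x) == Some a) by rewrite aheadE invg1 mul1g.
have across x z : swap_dom b c x -> ~~ swap_dom b c z -> len (z^-1 * x) = (len z + len x)%N.
  move=> hx hz; have [a [hxa hza]] : exists a, ahead 1 a x /\ ~~ ahead 1 a z.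
    by case/orP: hx hz => hx; rewrite negb_or => /andP[hb hc];
      [exists b|exists c]; rewrite !ah.
  by rewrite (size_across hxa hza) invg1 mulg1 mul1g size_inv.
move=> x z; rewrite !cayley_distE /swap_fun.
have [hx|hx] := boolP (swap_dom b c x); have [hz|hz] := boolP (swap_dom b c z) => //.
- by rewrite -swapwV -swapwM len_swapw.
- by rewrite ![len (_ * z)]size_invM !across // ?swap_dom_swapw // len_swapw.
- by rewrite !across // ?swap_dom_swapw // len_swapw.
Qed.

Definition swap b c : iso d := mk_iso (swap_subproof b c).

Lemma swap1 b c : iso_fun (swap b c) 1 = 1.
Proof. by []. Qed.

Lemma swap_gen b c : iso_fun (swap b c) (gen b) = gen c.
Proof.
have -> : iso_fun (swap b c) (gen b) = swap_fun b c (gen b) by [].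
by rewrite /swap_fun /swap_dom eqxx; apply: val_inj; rewrite /= /swapl eqxx.
Qed.

Lemma swap_fix b c a : a != b -> a != c -> iso_fun (swap b c) (gen a) = gen a.
Proof.
move=> ab ac; have -> : iso_fun (swap b c) (gen a) = swap_fun b c (gen a) by [].
by rewrite /swap_fun /swap_dom /= [Some a == Some b](negbTE ab) [Some a == Some c](negbTE ac).
Qed.

Lemma edge_transitive y a y' a' :
  exists k, iso_fun k y = y' /\ iso_fun k (y * gen a) = y' * gen a'.
Proof.
exists (transl y' * swap a a' * transl y^-1); rewrite !iso_funM !iso_transl.
by rewrite mulVg mulKg swap1 swap_gen mulg1.
Qed.

(** This is what makes the continuations of a geodesic equally likely. *)
Lemma star_transitive y a b b' : b != linv a -> b' != linv a ->
  exists k, [/\ iso_fun k y = y, iso_fun k (y * gen a) = y * gen a &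
    iso_fun k (y * gen a * gen b) = y * gen a * gen b'].
Proof.
move=> ba b'a; exists (transl (y * gen a) * swap b b' * transl (y * gen a)^-1).
rewrite !iso_funM !iso_transl mulVg mulKg swap1 swap_gen mulg1; split=> //.
rewrite invgM mulgVK gen_inv swap_fix 1?eq_sym //.
by rewrite -gen_inv mulgK.
Qed.

End Isometries.

(** * The non-backtracking walk on a finite graph *)

Section NonBacktracking.
Variables (d : nat) (C : finType) (step : C -> letter d -> C).
Hypothesis d_ge2 : (2 <= d)%N.
Hypothesis stepK : forall c a, step (step c a) (linv a) = c.
Local Notation Q := (C * letter d)%type.
Implicit Types (q : Q) (S : {set Q}) (V : {set C}).

(** The state [(c, a)] is the directed edge that leaves the vertex [c] along the letter
    [a]; a step goes on from its end without turning back. *)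
Definition next q q' := (q'.1 == step q.1 q.2) && (q'.2 != linv q.2).
Definition nexts S : {set Q} := [set q' | [exists q in S, next q q']]%SET.
Definition heads S : {set C} := [set step q.1 q.2 | q in S]%SET.

Lemma stepVK c a : step (step c (linv a)) a = c.
Proof. by rewrite -{2}(linvK a) stepK. Qed.

Lemma card_letter : #|{: letter d}| = d.*2.
Proof. by rewrite card_prod card_ord card_bool muln2. Qed.

Lemma card_neq (a : letter d) : #|[pred b | b != a]| = d.*2.-1.
Proof. by rewrite cardC1 card_letter. Qed.

Lemma card_succ q : #|[pred q' | next q q']| = d.*2.-1.
Proof.
rewrite -(card_neq (linv q.2)).
have inj : injective (fun b : letter d => (step q.1 q.2, b)) by move=> b b' [].
rewrite -(fintype.card_image inj); apply: eq_card => -[c b]; rewrite [LHS]inE /next /=.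
apply/andP/fintype.imageP => [[/eqP -> bq]|[b' bq [-> ->]]]; first by exists b.
by split.
Qed.

Lemma card_pred q : #|[pred q' | next q' q]| = d.*2.-1.
Proof.
rewrite -(card_neq (linv q.2)).
have inj : injective (fun a : letter d => (step q.1 (linv a), a)) by move=> b b' [].
rewrite -(fintype.card_image inj); apply: eq_card => -[c a]; rewrite [LHS]inE /next /=.
apply/andP/fintype.imageP => [[/eqP -> bq]|[b' bq [-> ->]]].
  exists a; last by rewrite stepK.
  by rewrite inE; apply: contraNN bq => /eqP ->; rewrite linvK.
rewrite stepVK eqxx; split=> //.
by apply: contraNN bq => /eqP ->; rewrite linvK.
Qed.

Lemma letter_avoid (a b : letter d) : exists c, c != a /\ c != b.
Proof.
suff : ([set a; b] \proper [set: letter d])%SET.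
  move=> /properP[_ [c _]]; rewrite !inE negb_or => /andP[ca cb].
  by exists c.
rewrite properEcard finset.subsetT cardsT card_letter cards2.
rewrite -muln2; apply: leq_trans (leq_mul d_ge2 (leqnn 2)).
by case: eqP.
Qed.

(** Every state has as many successors as predecessors. Counting the steps out of [S] by
    their source and by their target shows that the number of states cannot
    decrease, and that when it stays constant no step from outside [S] arrives in
    [nexts S]. *)
Lemma card_nexts S : (#|S| <= #|nexts S|)%N /\
  (#|nexts S| = #|S| -> forall q q', q' \in nexts S -> next q q' -> q \in S).
Proof.
set D := d.*2.-1; have D0 : (0 < D)%N.
  by rewrite /D -subn1 subn_gt0 -muln2; apply: leq_trans (leq_mul d_ge2 (leqnn 2)).
have E1 : (\sum_(q in S) \sum_(q' in nexts S) next q q' = #|S| * D)%N.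
  rewrite -sum_nat_const; apply: eq_bigr => q qS.
  rewrite /D -(card_succ q) -sum1_card [RHS]big_mkcond /= [LHS]big_mkcond /=.
  apply: eq_bigr => q' _; rewrite [q' \in pred_of_simpl _]inE.
  case: ifP => [_|]; first by case: next.
  rewrite inE; case: ifP => // qq' /negbT/negP[]; apply/existsP; exists q.
  by rewrite qS qq'.
have E2 : (\sum_(q in S) \sum_(q' in nexts S) next q q'
   = \sum_(q' in nexts S) \sum_(q in S) next q q')%N by exact: exchange_big.
have P q' : (\sum_(q in S) next q q' <= D ?= iff [forall (q | next q q'), q \in S])%N.
  have E : (\sum_(q in S) next q q' = #|[set q in S | next q q']%SET|)%N.
    rewrite -sum1_card [RHS]big_mkcond [LHS]big_mkcond /=.
    by apply: eq_bigr => q _; rewrite inE; case: (q \in S) => //=; case: next.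
  have ED : D = #|[set q | next q q']%SET| by rewrite cardsE card_pred.
  rewrite E ED; have sub : [set q in S | next q q']%SET \subset [set q | next q q']%SET.
    by apply/fintype.subsetP => q; rewrite !inE => /andP[].
  split; first exact: subset_leq_card.
  rewrite (subset_leqif_cards sub).2; apply/eqP/forallP => [/setP EE q|all].
    by apply/implyP => qq'; have := EE q; rewrite !inE qq' andbT => ->.
  by apply/setP => q; rewrite !inE; have := all q; case: (next q q') => /=; rewrite ?andbF ?andbT.
have [L LE] := leqif_sum (fun q' (_ : q' \in nexts S) => P q').
rewrite sum_nat_const -E2 E1 in L LE; split; first by move: L; rewrite leq_pmul2r.
move=> eqc; move: LE; rewrite eqc eqxx => /esym /forallP h q q' q'N qq'.
by have := h q'; rewrite q'N /= => /forallP /(_ q); rewrite qq'.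
Qed.

(** Two edges with the same end [c] have a common successor, because there are more than
    two letters. So when no step enters [nexts S] from outside, [S] consists
    of all the edges that end in some set of vertices, and [nexts S] of all the
    edges that leave it. *)
Lemma saturatedP S : #|nexts S| = #|S| ->
  (forall q, (q \in S) = (step q.1 q.2 \in heads S)) /\
  (forall q, (q \in nexts S) = (q.1 \in heads S)).
Proof.
move=> /(card_nexts S).2 sat; split=> q.
  apply/idP/imsetP => [qS|[q1 q1S e]]; first by exists q.
  have [b [b1 b2]] := letter_avoid (linv q.2) (linv q1.2).
  apply: (sat q (step q.1 q.2, b)); last by rewrite /next /= eqxx.
  by rewrite inE; apply/existsP; exists q1; rewrite q1S /next /= e eqxx.
apply/idP/imsetP => [|[q1 q1S e]].
  by rewrite inE => /existsP[q1 /andP[q1S /andP[/eqP e _]]]; exists q1.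
have [a [a1 a2]] := letter_avoid (linv q.2) (linv q1.2).
have [b [b1 b2]] := letter_avoid (linv q1.2) (linv a).
have aS : (step q.1 (linv a), a) \in S.
  apply: (sat _ (q.1, b)); last by rewrite /next /= stepVK eqxx.
  by rewrite inE; apply/existsP; exists q1; rewrite q1S /next /= e eqxx.
rewrite inE; apply/existsP; exists (step q.1 (linv a), a).
rewrite aS /next /= stepVK eqxx /=.
by apply: contraNN a1 => /eqP ->; rewrite linvK.
Qed.

Lemma card_heads S : (forall q, (q \in nexts S) = (q.1 \in heads S)) ->
  #|nexts S| = (#|heads S| * d.*2)%N.
Proof.
move=> h; rewrite -card_letter -[#|{: letter d}|]cardsT -cardsX; apply: eq_card => -[c a].
by rewrite h finset.in_setX finset.in_setT andbT.
Qed.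

Lemma heads_nexts S : (forall q, (q \in nexts S) = (q.1 \in heads S)) ->
  forall c a, c \in heads S -> step c a \in heads (nexts S).
Proof.
move=> h c a cS; apply/imsetP; exists (c, a) => //.
by rewrite h.
Qed.

(** For a connected graph this hypothesis says that it is not bipartite. *)
Hypothesis even_transitive : forall V : {set C}, V != finset.set0 ->
  (forall c a b, c \in V -> step (step c a) b \in V) -> V = [set: C]%SET.

Definition reach k q : {set Q} := iter k nexts [set q]%SET.

Lemma nexts_setT : nexts [set: Q]%SET = [set: Q]%SET.
Proof.
apply/eqP; rewrite eqEcard finset.subsetT /=.
by have [] := card_nexts [set: Q]%SET.
Qed.

(** The size of [reach k q] is bounded, so it is constant from some [k] on, and then
    the sets of vertices that are reached all have the same size. Going back and forth
    along an edge shows that two steps cannot lose a vertex; so the set of vertices is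
    stable under two steps. *)
Lemma reach_setT q : exists k, reach k q = [set: Q]%SET.
Proof.
have exP : exists n, [exists S : {set Q}, (#|S| == n) && `[< exists k, reach k q = S >]].
  exists #|reach 0 q|; apply/existsP; exists (reach 0 q); rewrite eqxx /=.
  by apply/asboolP; exists 0%N.
have ubP n : [exists S : {set Q}, (#|S| == n) && `[< exists k, reach k q = S >]] ->
    (n <= #|{: Q}|)%N.
  by move=> /existsP[S /andP[/eqP <- _]]; exact: max_card.
case: (ex_maxnP exP ubP) => n /existsP[S /andP[/eqP Sn /asboolP[k kS]]] nmax.
have stab i : #|iter i nexts S| = n.
  elim: i => //= i IH; apply/eqP; rewrite eqn_leq; apply/andP; split; last first.
    by rewrite -IH; have [] := card_nexts (iter i nexts S).
  apply: nmax; apply/existsP; exists (iter i.+1 nexts S); rewrite eqxx /=.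
  by apply/asboolP; exists (i.+1 + k)%N; rewrite /reach iterD -/(reach k q) kS.
have sat i := @saturatedP (iter i nexts S) (etrans (stab i.+1) (esym (stab i))).
have cV i : #|heads (iter i nexts S)| = #|heads S|.
  have := stab 1%N; rewrite -(stab i.+1) [LHS](card_heads (sat 0%N).2) [RHS](card_heads (sat i).2).
  by move=> /eqP; rewrite eqn_pmul2r ?double_gt0 1?ltnW // => /eqP.
have V02 : heads S = heads (iter 2 nexts S).
  apply/eqP; rewrite eqEcard cV leqnn andbT; apply/fintype.subsetP => c cS.
  rewrite -(stepK c (Ordinal d_ge2, true)).
  by apply: (heads_nexts (sat 1%N).2); exact: (heads_nexts (sat 0%N).2).
have VT : heads S = [set: C]%SET.
  apply: even_transitive => [|c a b cS]; last first.
    by rewrite V02; apply: (heads_nexts (sat 1%N).2); exact: (heads_nexts (sat 0%N).2).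
  have n0 : (0 < n)%N.
    apply: leq_trans (nmax #|reach 0 q| _).
      by rewrite card_gt0; apply/set0Pn; exists q; rewrite inE.
    by apply/existsP; exists (reach 0 q); rewrite eqxx; apply/asboolP; exists 0%N.
  have /card_gt0P[q1 q1S] : (0 < #|S|)%N by rewrite Sn.
  by apply/set0Pn; exists (step q1.1 q1.2); apply/imsetP; exists q1.
exists k; apply/setP => q1; rewrite kS finset.in_setT.
by rewrite ((sat 0%N).1 q1) VT finset.in_setT.
Qed.

Lemma reach_uniform : exists m, forall q, reach m q = [set: Q]%SET.
Proof.
pose K q := xget 0%N [set k | reach k q = [set: Q]%SET].
have KP q : reach (K q) q = [set: Q]%SET.
  have [k kP] := reach_setT q; rewrite /K.
  by case: xgetP => [j _ //|nP]; case: (nP k kP).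
exists (\max_q K q)%N => q; have /subnK <- := leq_bigmax q (F := K).
rewrite /reach iterD -/(reach (K q) q) KP.
by elim: (_ - _)%N => //= i ->; exact: nexts_setT.
Qed.

Section Averaging.
Variable R : realType.
Implicit Type H : Q -> R.

(** The transition operator of the non-backtracking walk. *)
Definition avg H q : R :=
  (d.*2.-1%:R)^-1 * \sum_(b | b != linv q.2) H (step q.1 q.2, b).

Let Dpos : (0 < d.*2.-1)%N.
Proof. by rewrite -subn1 subn_gt0 -muln2; apply: leq_trans (leq_mul d_ge2 (leqnn 2)). Qed.

Lemma avg_shift H t : avg (fun q => H q + t) = (fun q => avg H q + t).
Proof.
apply/funext => q; rewrite /avg big_split /= mulrDr; congr (_ + _).
rewrite sumr_const card_neq -[t *+ _]mulr_natl mulrA mulVf ?mul1r //.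
by rewrite pnatr_eq0 -lt0n.
Qed.

Lemma avg_ge0 H : (forall q, 0 <= H q) -> forall q, 0 <= avg H q.
Proof. by move=> H0 q; rewrite mulr_ge0 ?invr_ge0 ?ler0n // sumr_ge0. Qed.

Lemma avg_ge H q q' : (forall q, 0 <= H q) -> next q q' -> (d.*2.-1%:R)^-1 * H q' <= avg H q.
Proof.
case: q' => c b H0 /andP[/= /eqP -> bq]; rewrite /avg ler_wpM2l ?invr_ge0 ?ler0n //.
by rewrite (bigD1 b) //= lerDl sumr_ge0.
Qed.

Lemma iter_avg_ge0 k H : (forall q, 0 <= H q) -> forall q, 0 <= iter k avg H q.
Proof. by move=> H0; elim: k => //= k IH; exact: avg_ge0. Qed.

Lemma iter_avg_shift k H t : iter k avg (fun q => H q + t) = (fun q => iter k avg H q + t).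
Proof. by elim: k => //= k ->; rewrite avg_shift. Qed.

Lemma avgN H : avg (fun q => - H q) = (fun q => - avg H q).
Proof. by apply/funext => q; rewrite /avg sumrN mulrN. Qed.

Lemma iter_avgN k H : iter k avg (fun q => - H q) = (fun q => - iter k avg H q).
Proof. by elim: k => //= k ->; rewrite avgN. Qed.

Lemma iter_avg_ge k H q q' : (forall q, 0 <= H q) -> q' \in reach k q ->
  ((d.*2.-1%:R)^-1) ^+ k * H q' <= iter k avg H q.
Proof.
elim: k H q q' => [|k IH] H q q' H0.
  by rewrite expr0 mul1r inE => /eqP ->.
rewrite inE => /existsP[q1 /andP[q1R q1q']]; rewrite exprSr -mulrA iterSr.
apply: le_trans (IH _ _ q1 (avg_ge0 H0) q1R).
by rewrite ler_wpM2l ?exprn_ge0 ?invr_ge0 ?ler0n // avg_ge.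
Qed.

Lemma iter_avg_bounds k H lo hi : (forall q, lo <= H q <= hi) ->
  forall q, lo <= iter k avg H q <= hi.
Proof.
move=> HH q; apply/andP; split.
  have := @iter_avg_ge0 k (fun q => H q - lo) _ q; rewrite iter_avg_shift subr_ge0; apply.
  by move=> q'; rewrite subr_ge0; case/andP: (HH q').
have := @iter_avg_ge0 k (fun q => - H q + hi) _ q.
rewrite (iter_avg_shift _ (fun q => - H q)) iter_avgN addrC subr_ge0; apply.
by move=> q'; rewrite addrC subr_ge0; case/andP: (HH q').
Qed.

(** Doeblin's argument: once every state can be reached from every state in
    [m] steps, a large value of [H] somewhere raises all the values after [m] steps; if
    there is none, the upper bound can be lowered at once. *)
Lemma avg_contract : exists m, exists2 r : R, 0 <= r < 1 &
  forall H lo hi, lo <= hi -> (forall q, lo <= H q <= hi) ->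
  exists lo' hi', [/\ lo' <= hi', forall q, lo' <= iter m avg H q <= hi' &
    hi' - lo' <= r * (hi - lo)].
Proof.
have [m mP] := reach_uniform; exists m.
pose e : R := ((d.*2.-1%:R)^-1) ^+ m.
have De : 1 <= d.*2.-1%:R :> R by rewrite ler1n.
have D0 : 0 < d.*2.-1%:R :> R by exact: lt_le_trans ltr01 De.
have e0 : 0 < e by rewrite exprn_gt0 // invr_gt0.
have e1 : e <= 1 by rewrite exprn_ile1 ?invr_ge0 ?ler0n // invf_le1.
exists (1 - e / 2); first lra.
move=> H lo hi lohi HH; have itb := iter_avg_bounds m HH.
have [[q0 q0P]|nq] := pselect (exists q, (lo + hi) / 2 <= H q).
  exists (lo + e * ((hi - lo) / 2)), hi; split; [nra| |lra].
  move=> q; have /andP[_ ->] := itb q; rewrite andbT.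
  have := @iter_avg_ge m (fun q => H q - lo) q q0; rewrite iter_avg_shift mP finset.in_setT.
  move=> /(_ _ isT); rewrite lerBrDl => h; apply: le_trans (h _).
    by rewrite lerD2l; apply: ler_wpM2l; [exact: ltW|lra].
  by move=> q'; rewrite subr_ge0; case/andP: (HH q').
exists lo, ((lo + hi) / 2); split; [lra| |nra].
apply: iter_avg_bounds => q; have /andP[-> _] /= := HH q; rewrite leNgt; apply/negP => /ltW h.
by apply: nq; exists q.
Qed.

(** The bound [k0] does not depend on [H]: this uniformity is needed because the
    observable of [decorrelation] moves with [v]. *)
Lemma avg_mixing (e : R) : 0 < e -> exists k0, forall k, (k0 <= k)%N ->
  forall H, (forall q, 0 <= H q <= 1) ->
  exists lo, forall q, lo <= iter k avg H q <= lo + e.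
Proof.
move=> e0; have [m [r /andP[r0 r1] contr]] := avg_contract.
have itern n H : (forall q, 0 <= H q <= 1) -> exists lo hi,
    [/\ lo <= hi, forall q, lo <= iter (n * m) avg H q <= hi & hi - lo <= r ^+ n].
  move=> H01; elim: n => [|n [lo [hi [lohi loH IH]]]].
    by exists 0, 1; split => //; rewrite subr0 expr0.
  have [lo' [hi' [lohi' loH' h]]] := contr _ _ _ lohi loH.
  exists lo', hi'; split => //; first by move=> q; rewrite mulSn iterD.
  by rewrite exprS (le_trans h) // ler_wpM2l.
have [n rn] : exists n, r ^+ n <= e.
  have /cvgrPdist_le /(_ e e0) [n _ nP] : (fun n => r ^+ n) @ \oo --> (0 : R).
    by apply: cvg_expr; rewrite ger0_norm.
  exists n; have := nP n (leqnn n); rewrite sub0r normrN ger0_norm //.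
  by rewrite exprn_ge0.
exists (n * m)%N => k nk H H01; have [lo [hi [lohi loH hl]]] := itern n H H01.
exists lo => q; have /andP[h1 h2] := iter_avg_bounds (k - n * m) loH q.
rewrite -iterD subnK // in h1 h2; rewrite h1 (le_trans h2) //.
by rewrite -lerBlDl (le_trans hl).
Qed.

End Averaging.
End NonBacktracking.

(** * Topology of the isometry group *)

Lemma compact_bounded (X : ptopologicalType) (A : set X) (phi : X -> nat) :
  (forall n, open [set x | (phi x <= n)%N]) -> compact A ->
  exists N, forall x, A x -> (phi x <= N)%N.
Proof.
move=> phio; rewrite compact_cover => /(_ nat setT (fun n => [set x | (phi x <= n)%N])).
case=> [n _|x Ax|D _ AD]; [exact: phio|by exists (phi x) => //=|].
exists (\max_(i <- finmap.enum_fset D) i)%N => x /AD[i /= iD xi].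
by apply: leq_trans xi _; apply: leq_bigmax_seq.
Qed.

Section IsoTopology.
Variable d : nat.
Implicit Types (f g h : iso d) (S : seq (free_group d)) (E U : set (iso d)).

Definition agree_on S f g := {in S, iso_fun f =1 iso_fun g}.

(** Vertices form a discrete space, so pointwise convergence means that each value is
    eventually constant. *)
Lemma cvg_isoP (F : set_system (iso d)) f : Filter F ->
  (forall x, F [set g | iso_fun g x = iso_fun f x]) -> F --> f.
Proof.
move=> FF Fx U /=.
case=> _ [] [W oW <-] /= Wf WU; apply: (filterS WU).
have : (set_val @ F) --> (set_val f : {ptws free_group d -> free_group d}).
  apply/cvg_sup => x V [_ [[B oB <-] /= Bf BV]].
  change (F (set_val @^-1` V)); apply: filterS (Fx x) => g gx; apply: BV.
  by change (B (iso_fun g x)); rewrite (gx : _ = _).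
by move=> /(_ W); apply; exact: open_nbhs_nbhs.
Qed.

Lemma nbhs_eval f x : nbhs f [set g | iso_fun g x = iso_fun f x].
Proof.
exists (@set_val _ (@iso_set d) @^-1`
  (@proj _ (fun=> free_group d) x @^-1` [set iso_fun f x])).
split => //=; eexists; last by [].
have c : continuous (proj x : {ptws free_group d -> free_group d} -> free_group d).
  exact: proj_continuous.
by move/continuousP: c; apply; exact: discrete_open.
Qed.

Lemma nbhs_agree S f : nbhs f [set g | agree_on S g f].
Proof.
elim: S => [|x S IH]; first by apply: filterS filterT.
apply: filterS (filterI (nbhs_eval f x) IH) => g [gx gS] y.
by rewrite inE => /predU1P[->|/gS].
Qed.

Lemma nbhs_isoP f U : nbhs f U <-> exists S, forall g, agree_on S g f -> U g.
Proof.
split=> [|[S SU]]; last exact: filterS SU (nbhs_agree S f).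
pose F : set_system (iso d) := filter_from setT (fun S => [set g | agree_on S g f]).
have FF : Filter F.
  apply: filter_from_filter; first by exists [::].
  move=> S T _ _; exists (S ++ T) => // g gST; split => x xS; apply: gST;
    by rewrite mem_cat xS ?orbT.
suff /(_ U) FU : F --> f by move=> /FU[S _ SU]; exists S.
apply: cvg_isoP => x; exists [:: x] => // g; apply; exact: mem_head.
Qed.

Lemma open_isoP U : open U <-> forall f, U f -> exists S, forall g, agree_on S g f -> U g.
Proof.
rewrite openE; split=> [oU f /oU /nbhs_isoP //|h f /h Uf].
exact/nbhs_isoP.
Qed.

Definition determined S E := forall f g, agree_on S f g -> E f -> E g.

Lemma agree_sym S f g : agree_on S f g -> agree_on S g f.
Proof. by move=> fg x xS; rewrite fg. Qed.

Lemma determined_open S E : determined S E -> open E.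
Proof. by move=> dE; apply/open_isoP => f Ef; exists S => g /agree_sym gf; exact: dE gf Ef. Qed.

Lemma determined_sub S T E : {subset S <= T} -> determined S E -> determined T E.
Proof. by move=> ST dE f g fg; apply: dE => x /ST; exact: fg. Qed.

Lemma determinedI S E E' : determined S E -> determined S E' -> determined S (E `&` E').
Proof. by move=> dE dE' f g fg [/(dE _ _ fg) ? /(dE' _ _ fg)]. Qed.

Lemma determined_eval x (P : set (free_group d)) : determined [:: x] [set f | P (iso_fun f x)].
Proof. by move=> f g fg; rewrite /= fg // mem_head. Qed.

Lemma compact_iso_bounded E : compact E -> exists N, forall f, E f -> (len (iso_fun f 1%g) <= N)%N.
Proof.
apply: compact_bounded => n; apply: (@determined_open [:: 1%g]).
exact: (@determined_eval 1%g [set z | (len z <= n)%N]).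
Qed.

Lemma compact_fg_bounded (A : set (free_group d)) : compact A ->
  exists N, forall x, A x -> (len x <= N)%N.
Proof. by apply: compact_bounded => n; exact: discrete_open. Qed.

Lemma ultra_finite (T V : choiceType) (F : set_system T) (B : set V) (phi : T -> V) :
  UltraFilter F -> finite_set B -> F [set t | B (phi t)] ->
  exists v, F [set t | phi t = v].
Proof.
move=> UF /finite_fsetP[D ->] FB; apply: contrapT => nex.
have h v : F [set t | phi t <> v].
  have [Fv|//] := in_ultra_setVsetC [set t | phi t = v] UF.
  by case: nex; exists v.
have FF : Filter F by exact _.
have FD := filter_bigI (D := D) FF (fun v _ => h v).
by have [t [Bt /(_ _ Bt)]] := filter_ex (filterI FB FD).
Qed.

(** On such isometries the image and the preimage of a vertex take finitely many values, so
    along an ultrafilter they are eventually constant; the limits of the isometries and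
    of their inverses are inverse to each other. *)
Lemma compact_ball n : compact [set f : iso d | (len (iso_fun f 1%g) <= n)%N].
Proof.
rewrite compact_ultra => F UF FB.
have bd f x : (len (iso_fun f 1%g) <= n -> len (iso_fun f x) <= n + len x)%N.
  move=> fn; rewrite -[iso_fun f x](mulVKg (iso_fun f 1%g)).
  apply: leq_trans (size_mul_le _ _) _; rewrite iso_len invg1 mul1g.
  by rewrite leq_add2r.
have bdV f y : (len (iso_fun f 1%g) <= n -> len (iso_fun f^-1%g y) <= n + len y)%N.
  move=> fn; have -> : iso_fun f^-1%g y = (1^-1 * iso_fun f^-1%g y)%g by rewrite invg1 mul1g.
  rewrite -(iso_len f) iso_funVK; apply: leq_trans (size_mul_le _ _) _.
  by rewrite size_inv leq_add2r.
have /choice[phi phiP] x : exists v, F [set f | iso_fun f x = v].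
  apply: (ultra_finite (B := [set v | (len v <= n + len x)%N])); first exact: finite_ball.
  by apply: filterS FB => f /=; exact: bd.
have /choice[psi psiP] y : exists v, F [set f | iso_fun f^-1%g y = v].
  apply: (ultra_finite (B := [set v | (len v <= n + len y)%N])); first exact: finite_ball.
  by apply: filterS FB => f /=; exact: bdV.
have phi_iso : iso_set phi.
  split.
    exists psi => [x|y].
      have [f /= [<- <-]] := filter_ex (filterI (psiP (phi x)) (phiP x)).
      exact: iso_funV.
    have [f /= [<- <-]] := filter_ex (filterI (phiP (psi y)) (psiP y)).
    exact: iso_funVK.
  move=> x y; have [f /= [<- <-]] := filter_ex (filterI (phiP x) (phiP y)).
  by rewrite !cayley_distE iso_len.
exists (mk_iso phi_iso); split; last by apply: cvg_isoP => x; exact: phiP.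
have [f [fn f1]] := filter_ex (filterI FB (phiP 1%g)).
by change (len (phi 1%g) <= n)%N; rewrite -(f1 : iso_fun f 1%g = phi 1%g).
Qed.

End IsoTopology.

(** * Counting fibres and convergence of measures *)

Section Measure.
Context disp (T : measurableType disp) (R : realType).
Implicit Types (A B E : set T).

(** Both measures give a common mass to all the fibres of the finite-valued map [rho], so
    on a union of fibres they count fibres. This replaces uniqueness
    of Haar measure throughout. *)
Lemma measure_ratio (V : choiceType) (rho : T -> V) (Om E : set T)
    (nu nu' : {measure set T -> \bar R}) :
  finite_set (rho @` Om) ->
  (forall v, measurable (Om `&` [set x | rho x = v])) ->
  (forall x y, Om x -> Om y ->
    nu (Om `&` [set z | rho z = rho x]) = nu (Om `&` [set z | rho z = rho y])) ->
  (forall x y, Om x -> Om y ->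
    nu' (Om `&` [set z | rho z = rho x]) = nu' (Om `&` [set z | rho z = rho y])) ->
  E `<=` Om -> (forall x y, Om x -> Om y -> rho x = rho y -> E x -> E y) ->
  (nu E * nu' Om = nu' E * nu Om)%E.
Proof.
move=> finO mO cnu cnu' EO sat.
have [[x0 Ox0]|nO] := pselect (exists x, Om x); last first.
  have O0 : Om = set0 by apply/seteqP; split=> // x Ox; case: nO; exists x.
  by rewrite O0 !measure0 !mule0.
pose c (m : {measure set T -> \bar R}) := m (Om `&` [set z | rho z = rho x0]).
have count (m : {measure set T -> \bar R}) B : B `<=` Om ->
    (forall x y, Om x -> Om y -> rho x = rho y -> B x -> B y) ->
    (forall x, Om x -> m (Om `&` [set z | rho z = rho x]) = c m) ->
    m B = ((size (finmap.enum_fset (fset_set (rho @` B))))%:R%:E * c m)%E.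
  move=> BO Bsat mc.
  have finB : finite_set (rho @` B) by apply: sub_finite_set finO; exact: image_subset.
  have BE : B = \bigcup_(v in rho @` B) (Om `&` [set x | rho x = v]).
    apply/seteqP; split=> [x Bx|x [_ [y By <-] [Ox xy]]].
      by exists (rho x); [exists x|split => //; exact: BO].
    exact: Bsat (BO _ By) Ox (esym xy) By.
  rewrite {1}BE measure_fin_bigcup //; last first.
    by move=> v w _ _ [x [[_ <-] [_ <-]]].
  rewrite (eq_fsbigr (fun=> c m)); last first.
    by move=> _ /set_mem[x Bx <-]; apply: mc; exact: BO.
  rewrite fsbig_finite //; elim: (finmap.enum_fset _) => [|v s IH].
    by rewrite big_nil mul0e.
  by rewrite big_cons IH /= -natr1 addrC EFinD ge0_muleDl ?lee_fin // mul1e.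
have cE := fun x Ox => cnu x x0 Ox Ox0; have cE' := fun x Ox => cnu' x x0 Ox Ox0.
rewrite (count nu E) // (count nu' E) // (count nu Om) // (count nu' Om) //.
by rewrite muleACA [in RHS]muleACA [(c nu * c nu')%E]muleC.
Qed.

Variable P : probability T R.
Implicit Types (I : Type).
Local Notation p A := (fine (P A)).

Lemma fine_prob A : measurable A -> ((p A)%:E = P A)%E.
Proof. by move=> mA; rewrite fineK // fin_num_measure. Qed.

Lemma fine_probU A B : measurable A -> measurable B -> A `&` B = set0 ->
  p (A `|` B) = p A + p B.
Proof. by move=> mA mB AB; rewrite measureU // fineD // fin_num_measure. Qed.

Lemma fine_prob_ge0 A : 0 <= p A.
Proof. exact: fine_ge0. Qed.

Lemma fine_prob_le A B : measurable A -> measurable B -> A `<=` B -> p A <= p B.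
Proof.
by move=> mA mB AB; apply: fine_le; rewrite ?fin_num_measure //; apply: le_measure; rewrite ?inE.
Qed.

Lemma fine_probT : p setT = 1.
Proof. by rewrite probability_setT. Qed.

Lemma fine_prob_tail (F : nat -> set T) : (forall n, measurable (F n)) -> trivIset setT F ->
  forall e : R, 0 < e -> exists n, p (\bigcup_k F k `\` \big[setU/set0]_(k < n) F k) <= e.
Proof.
move=> mF tF e e0.
have mU : measurable (\bigcup_k F k) by exact: bigcup_measurable.
have mUn n : measurable (\big[setU/set0]_(k < n) F k) by exact: bigsetU_measurable.
have : (fun n => (\sum_(0 <= i < n) P (F i))%E) @ \oo --> P (\bigcup_k F k).
  exact: measure_semi_sigma_additive.
rewrite -(fine_prob mU) => /fine_cvg /cvgrPdist_le /(_ e e0) [n _ /(_ n (leqnn n)) /= h].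
exists n; move: h; rewrite big_mkord -measure_bigsetU //.
set Un := \big[setU/set0]_(k < n) F k.
have UnU : Un `<=` \bigcup_k F k.
  by rewrite /Un -bigcup_mkord => x [k _ Fx]; exists k.
have -> : p (\bigcup_k F k) = p Un + p (\bigcup_k F k `\` Un).
  rewrite -[in LHS](setDUK UnU) fine_probU //;
    [exact: mUn|exact: measurableD (mUn n)|exact: setDIK].
by rewrite addrAC subrr add0r ger0_norm // fine_prob_ge0.
Qed.

Definition fin_additive (m : set T -> R) := forall A B, measurable A -> measurable B ->
  A `&` B = set0 -> m (A `|` B) = m A + m B.

(** Stated for real-valued set functions, so that it covers both arguments of
    a correlation and its limit. *)
Definition dominated (m : set T -> R) := forall A, measurable A -> 0 <= m A <= p A.

(** Domination by one probability makes the tails of countable unions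
    uniformly small, so the sets on which the [nu i] converge to [nu0] form a
    Dynkin system. *)
Lemma dominated_set_cvg I (F : set_system I) (FF : Filter F) (G : set (set T))
  (nu : I -> set T -> R) (nu0 : set T -> R) :
  @measurable _ T = <<s G >> -> setI_closed G -> G setT ->
  (forall i, fin_additive (nu i)) -> fin_additive nu0 ->
  (forall i, dominated (nu i)) -> dominated nu0 ->
  (forall A, G A -> forall e : R, 0 < e -> F [set i | `|nu i A - nu0 A| <= e]) ->
  forall A, measurable A -> forall e : R, 0 < e -> F [set i | `|nu i A - nu0 A| <= e].
Proof.
move=> gen GI GT anu anu0 dnu dnu0 cG A; rewrite gen => mA.
have GM B : G B -> measurable B by rewrite gen; exact: sub_gen_smallest.
pose C B := forall e : R, 0 < e -> F [set i | `|nu i B - nu0 B| <= e].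
have CD A1 A2 : measurable A1 -> measurable A2 -> A1 `&` A2 = set0 -> C A1 -> C A2 -> C (A1 `|` A2).
  move=> m1 m2 A12 C1 C2 e e0; have e20 : 0 < e / 2 by lra.
  apply: filterS (filterI (C1 _ e20) (C2 _ e20)) => i /= [h1 h2].
  rewrite anu // anu0 // opprD addrACA; apply: le_trans (ler_normD _ _) _; lra.
apply: (@dynkin_induction _ T G C gen GI _ _ _ _ A mA); [exact: cG|exact: cG| |].
  move=> S mS CS e e0; have e20 : 0 < e / 2 by lra.
  apply: filterS (filterI (CS _ e20) (cG _ GT _ e20)) => i /= [h1 h2].
  have mSC : measurable (~` S) by exact: measurableC.
  have E := anu i S (~` S) mS mSC (setICr S); have E0 := anu0 S (~` S) mS mSC (setICr S).
  rewrite setUCr in E E0.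
  rewrite ler_norml in h1; rewrite ler_norml in h2; rewrite ler_norml.
  move/andP: h1 => [? ?]; move/andP: h2 => [? ?]; apply/andP; split; lra.
move=> S mS tS CS e e0; have e20 : 0 < e / 2 by lra.
have mU : measurable (\bigcup_k S k) by exact: bigcup_measurable.
have mUn n : measurable (\big[setU/set0]_(k < n) S k) by exact: bigsetU_measurable.
have CUn n : C (\big[setU/set0]_(k < n) S k).
  elim: n => [|n IH].
    have z (m : set T -> R) : fin_additive m -> m set0 = 0.
      by move=> /(_ set0 set0 measurable0 measurable0 (setI0 _)); rewrite setU0; lra.
    move=> e' e'0; rewrite big_ord0; apply: filterS filterT => i _ /=.
    by rewrite !z // subrr normr0 ltW.
  rewrite big_ord_recr /=; apply: (CD _ _ (mUn n) (mS n) _ IH (CS n)).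
  rewrite -bigcup_mkord; apply/seteqP; split=> // x [[k /= kn Skx] Snx].
  have := tS k n Logic.I Logic.I (ex_intro _ x (conj Skx Snx)) => kE.
  by move: kn; rewrite kE ltnn.
have [n nP] := fine_prob_tail mS tS e20.
apply: filterS (CUn n _ e20) => i /= h.
set U := \bigcup_k S k in mU nP *; set Un := \big[setU/set0]_(k < n) S k in h nP *.
have UnU : Un `<=` U.
  by rewrite /Un -bigcup_mkord => x [k _ Fx]; exists k.
have mD : measurable (U `\` Un) by exact: measurableD mU (mUn n).
have D0 : Un `&` (U `\` Un) = set0 by rewrite setDIK.
rewrite -(setDUK UnU) (anu i _ _ (mUn n) mD D0) (anu0 _ _ (mUn n) mD D0).
have /andP[? ?] := dnu i _ mD; have /andP[? ?] := dnu0 _ mD.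
rewrite ler_norml in h; move/andP: h => [? ?].
rewrite ler_norml; apply/andP; split; lra.
Qed.

End Measure.

Section Partition.
Context disp (T : measurableType disp) (R : realType) (mu : {measure set T -> \bar R}).

Lemma measure_seq_partition (V : eqType) (phi : T -> V) (s : seq V) (E : set T) :
  uniq s -> (forall v, measurable (E `&` [set x | phi x = v])) ->
  mu (E `&` [set x | phi x \in s]) = (\sum_(v <- s) mu (E `&` [set x | phi x = v]))%E.
Proof.
move=> us mE; elim: s us => [_|v s IH /andP[vs us]].
  by rewrite big_nil -[RHS](measure0 mu); congr (mu _); apply/seteqP; split=> // x [].
have mS (s' : seq V) : measurable (E `&` [set x | phi x \in s']).
  elim: s' => [|w s' IH'].
    have -> : E `&` [set x | phi x \in [::]] = set0 by apply/seteqP; split=> // x [].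
    exact: measurable0.
  rewrite (_ : _ `&` _ = (E `&` [set x | phi x = w]) `|` (E `&` [set x | phi x \in s'])).
    exact: measurableU.
  rewrite -setIUr; congr (_ `&` _); apply/seteqP; split=> x /=; rewrite inE.
    by move=> /predU1P[]; [left|right].
  by move=> [->|->]; rewrite ?eqxx ?orbT.
rewrite big_cons -IH // -measureU //; last first.
  apply/seteqP; split=> // x [[_ /= xv] [_ /=]]; rewrite xv.
  by rewrite (negbTE vs).
congr (mu _); rewrite -setIUr; congr (_ `&` _); apply/seteqP; split=> x /=; rewrite inE.
  by move=> /predU1P[]; [left|right].
by move=> [->|->]; rewrite ?eqxx ?orbT.
Qed.

Lemma measure_fin_partition (V : finType) (phi : T -> V) (E : set T) :
  (forall v, measurable (E `&` [set x | phi x = v])) ->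
  mu E = (\sum_v mu (E `&` [set x | phi x = v]))%E.
Proof.
move=> mE; rewrite -[RHS]big_enum /= -measure_seq_partition ?enum_uniq //.
congr (mu _); apply/seteqP; split=> [x Ex|x []//]; split=> //=.
by rewrite mem_enum.
Qed.

Lemma measure_nat_partition (phi : T -> nat) (E : set T) :
  (forall n, measurable (E `&` [set x | phi x = n])) ->
  mu E = (\sum_(0 <= n <oo) mu (E `&` [set x | phi x = n]))%E.
Proof.
move=> mE.
have -> : mu E = mu (\bigcup_n (E `&` [set x | phi x = n])).
  congr (mu _); apply/seteqP; split=> [x Ex|x [n _ []]//].
  by exists (phi x).
rewrite measure_bigcup //; first by apply: eq_eseriesl => n; rewrite in_setT.
by move=> m n _ _ [x [[_ /= <-] [_ /= <-]]].
Qed.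
End Partition.

Section BorelPreimage.
Variables (T U : ptopologicalType) (h : T -> U).
Hypothesis h_cont : forall A, open A -> open (h @^-1` A).

Lemma measurable_borel : measurable_fun setT (h : borel T -> borel U).
Proof.
apply: (@measurability _ _ (borel T) (borel U) _ _ open) => //.
by move=> _ [A oA <-]; rewrite setTI; apply: sub_gen_smallest; exact: h_cont.
Qed.

Lemma measurable_preimage (A : set (borel U)) :
  measurable A -> measurable (h @^-1` A : set (borel T)).
Proof. by move=> mA; rewrite -[X in measurable X]setTI; exact: measurable_borel. Qed.
End BorelPreimage.

(** * Left invariant measures and independence across an edge *)

Section LeftInvariant.
Variables (d : nat) (R : realType) (eta : {measure set (borel (iso d)) -> \bar R}).
Implicit Types (a b : letter d) (x y z v : free_group d) (f g k : iso d)
  (S : seq (free_group d)) (E : set (borel (iso d))).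

Lemma measurable_determined S E : determined S E -> measurable E.
Proof. by move=> /determined_open oE; exact: sub_gen_smallest. Qed.

Definition lmul k : iso d -> iso d := fun f => (k * f)%g.
Definition rmul k : iso d -> iso d := fun f => (f * k)%g.

Lemma lmul_cont k U : open U -> open (lmul k @^-1` U).
Proof.
move=> /open_isoP oU; apply/open_isoP => f /oU[S SU]; exists S => g gf.
by apply: SU => x xS; rewrite !iso_funM gf.
Qed.

Lemma rmul_cont k U : open U -> open (rmul k @^-1` U).
Proof.
move=> /open_isoP oU; apply/open_isoP => f /oU[S SU].
exists (map (iso_fun k) S) => g gf; apply: SU => x xS; rewrite !iso_funM gf //.
exact: map_f.
Qed.

Definition pt x y : set (borel (iso d)) := [set f | iso_fun f x = y].

Lemma determined_pt x y : determined [:: x] (pt x y).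
Proof. exact: (@determined_eval _ x [set y]). Qed.

Lemma measurable_pt x y : measurable (pt x y).
Proof. exact: measurable_determined (@determined_pt x y). Qed.

Definition edge v b y a : set (borel (iso d)) := pt v y `&` pt (v * gen b)%g (y * gen a)%g.

Lemma measurable_edge v b y a : measurable (edge v b y a).
Proof. by apply: measurableI; exact: measurable_pt. Qed.

Lemma finite_restr S v y : finite_set ((fun f => map (iso_fun f) S) @` pt v y).
Proof.
elim: S => [|x S IH].
  by apply: (sub_finite_set _ (finite_set1 [::])) => _ [f _ <-].
have fB := finite_ball d (len y + len (v^-1 * x)).
apply: sub_finite_set (finite_image2 cons fB IH) => _ [f fv <-].
exists (iso_fun f x) => /=; last by exists (map (iso_fun f) S) => //; exists f.
rewrite -(mulVKg y (iso_fun f x)); apply: leq_trans (size_mul_le _ _) _.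
by rewrite -{2}(fv : _ = y) iso_len.
Qed.

Hypothesis eta_inv : forall k E, measurable E -> eta (lmul k @^-1` E) = eta E.
Hypothesis eta_fin : forall x y, (eta (pt x y) < +oo)%E.
Hypothesis eta_neq0 : eta setT <> 0%E.

Lemma eta_fin_sub x y E : measurable E -> E `<=` pt x y -> (eta E < +oo)%E.
Proof.
move=> mE Exy; apply: le_lt_trans (eta_fin x y); apply: le_measure; rewrite ?inE //.
exact: measurable_pt.
Qed.

Lemma eta_pt x y y' : eta (pt x y) = eta (pt x y').
Proof.
rewrite -(eta_inv (transl (y' * y^-1)%g) (measurable_pt x y')); congr (eta _).
apply/seteqP; split=> f; rewrite /pt /lmul /=.
  by move=> h; rewrite -[LHS]/((y' * y^-1) * iso_fun f x)%g h mulgVK.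
move=> h; have : ((y' * y^-1) * iso_fun f x)%g = y' := h.
by rewrite -mulgA -{2}(mulg1 y') => /mulgI /mulg1_eq; rewrite invgK.
Qed.

(** The countably many values that an isometry takes at [x] have the same mass, and
    together the mass of everything. *)
Lemma eta_pt_gt0 x y : (0 < eta (pt x y))%E.
Proof.
rewrite lt0e measure_ge0 andbT; apply/eqP => e0; apply: eta_neq0.
rewrite (@measure_nat_partition _ (borel (iso d)) R eta (fun f => pickle (iso_fun f x))).
  apply: eseries0 => n _ _; rewrite setTI.
  have [[z zn]|nz] := pselect (exists z : free_group d, pickle z = n); last first.
    rewrite -[RHS](measure0 eta); congr (eta _); apply/seteqP; split=> // f /= fn.
    by apply: nz; exists (iso_fun f x).
  rewrite -[RHS]e0 (eta_pt x y z); congr (eta _); apply/seteqP; split=> f /=; rewrite /pt /= -zn.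
    exact: (pcan_inj pickleK).
  by move=> ->.
move=> n; rewrite setTI; apply: (@measurable_determined [:: x]).
exact: (@determined_eval _ x [set z | pickle z = n]).
Qed.

Lemma eta_edge v b y a y' a' : eta (edge v b y a) = eta (edge v b y' a').
Proof.
have [k [ky kya]] := edge_transitive y a y' a'.
rewrite -(eta_inv k (measurable_edge v b y' a')); congr (eta _).
apply/seteqP; split=> f [fv fvb]; split; rewrite /pt /lmul /= ?iso_funM in fv fvb *.
- by rewrite fv.
- by rewrite fvb.
- by apply: (@iso_inj _ k); rewrite ky.
- by apply: (@iso_inj _ k); rewrite kya.
Qed.

Lemma pt_edges v b y E : measurable E ->
  eta (E `&` pt v y) = (\sum_a eta (E `&` edge v b y a))%E.
Proof.
move=> mE.
(* The word has length one, so the default value [b] is never used. *)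
pose phi f := head b (val ((iso_fun f v)^-1 * iso_fun f (v * gen b))%g).
have phiE f a : iso_fun f v = y -> (phi f = a) <-> (iso_fun f (v * gen b)%g = y * gen a)%g.
  have [c fc] := iso_adj f v b; rewrite /phi fc => ->; rewrite mulKg /=.
  split=> [->//|/mulgI/(congr1 val)[]//].
have E' a : E `&` pt v y `&` [set f | phi f = a] = E `&` edge v b y a.
  rewrite /edge -setIA; congr (_ `&` _); apply/seteqP; split=> f [fv h]; split=> //.
    by apply/(phiE _ _ fv).
  by apply/(phiE _ _ fv).
rewrite (@measure_fin_partition _ (borel (iso d)) R eta _ phi).
  by apply: eq_bigr => a _; rewrite E'.
by move=> a; rewrite E'; apply: measurableI => //; exact: measurable_edge.
Qed.

Lemma edge_sub v b y a : edge v b y a `<=` pt v y.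
Proof. by move=> f []. Qed.

Lemma eta_edge_fin v b y a : (eta (edge v b y a) < +oo)%E.
Proof. exact: eta_fin_sub (measurable_edge v b y a) (@edge_sub v b y a). Qed.

Lemma eta_edge_gt0 v b y a : (0 < eta (edge v b y a))%E.
Proof.
rewrite lt0e measure_ge0 andbT; apply/eqP => e0.
have := eta_pt_gt0 v y; rewrite -[pt v y]setTI (@pt_edges v b y) // big1 ?ltxx // => c _.
by rewrite setTI (eta_edge _ _ _ _ y a).
Qed.

Definition behind v b E := forall f g,
  (forall x, ~~ ahead v b x -> iso_fun f x = iso_fun g x) -> E f -> E g.

(** Conditional independence across an edge. The measure [nu] below, which is [eta]
    restricted to the event [E1] behind the edge, is still invariant under the isometries
    that fix the half-tree behind the image of the edge, and these permute transitively
    the possible restrictions to [S]. So [nu] and [eta] both count restrictions to [S]. *)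
Lemma edge_indep v b y a E1 E2 S : measurable E1 -> behind v b E1 ->
  determined S E2 -> (forall x, x \in S -> ahead v b x) ->
  (eta (E1 `&` E2 `&` edge v b y a) * eta (edge v b y a) =
   eta (E2 `&` edge v b y a) * eta (E1 `&` edge v b y a))%E.
Proof.
move=> mE1 bE1 dE2 aS; set Om := edge v b y a.
have mOm : measurable Om := measurable_edge v b y a.
pose rho (f : borel (iso d)) := map (iso_fun f) S.
have rhoP f g : rho f = rho g <-> agree_on S f g by split=> [/eq_in_map|fg]; [|exact/eq_in_map].
have mfib w : measurable (Om `&` [set f | rho f = w]).
  apply: measurableI => //; apply: (@measurable_determined S) => f g fg /=.
  by move=> <-; apply/rhoP; exact: agree_sym.
have move_fib F f g : measurable F -> behind v b F -> Om f -> Om g ->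
    eta (Om `&` [set h | rho h = rho f] `&` F) = eta (Om `&` [set h | rho h = rho g] `&` F).
  move=> mF bF [fv fvb] [gv gvb].
  have k0y : iso_fun (g * f^-1)%g y = y by rewrite iso_funM -{1}(fv : _ = y) iso_funV.
  have k0ya : iso_fun (g * f^-1)%g (y * gen a)%g = (y * gen a)%g.
    by rewrite iso_funM -{1}(fvb : _ = (y * gen a)%g) iso_funV.
  (* [k] carries [f] to [g] on [S] without changing anything behind the edge. *)
  set k := glue_iso k0y k0ya.
  have kE x : iso_fun k x = if ahead y a x then iso_fun (g * f^-1)%g x else x by [].
  have ky : iso_fun k y = y by rewrite kE; case: ifP.
  have kya : iso_fun k (y * gen a)%g = (y * gen a)%g by rewrite kE; case: ifP.
  rewrite -(eta_inv k (measurableI _ _ (mfib (rho g)) mF)); congr (eta _).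
  have common h : Om h -> [/\ Om (lmul k h), rho (lmul k h) = rho g <-> rho h = rho f
      & F (lmul k h) <-> F h].
    move=> [hv hvb]; split.
    - by split; rewrite /pt /lmul /= ?iso_funM ?hv ?hvb.
    - split=> /rhoP hS; apply/rhoP => x xS.
        have := hS x xS; rewrite /lmul iso_funM kE (ahead_iso x hv hvb) aS // iso_funM.
        by move=> /iso_inj e; rewrite -(iso_funVK f (iso_fun h x)) e.
      by rewrite /lmul iso_funM kE (ahead_iso x hv hvb) aS // iso_funM hS // iso_funV.
    - split; apply: bF => x nx; rewrite /lmul iso_funM kE (ahead_iso x hv hvb);
        by rewrite (negbTE nx).
  apply/seteqP; split=> h.
    move=> [[Oh hf] Fh]; have [okh [_ r1] [_ F1]] := common h Oh.
    by split; [split=> //; exact: r1 hf|exact: F1].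
  move=> [[Okh hg] Fh].
  have Oh : Om h.
    case: Okh => hy hya; split; apply: (@iso_inj _ k).
      by rewrite ky; exact: hy.
    by rewrite kya; exact: hya.
  have [_ [r1 _] [F1 _]] := common h Oh.
  by split; [split=> //; exact: r1 hg|exact: F1].
pose nu : {measure set (borel (iso d)) -> \bar R} := mrestr eta mE1.
have nuE F : nu F = eta (F `&` E1) by [].
have := @measure_ratio _ (borel (iso d)) R _ rho Om (E2 `&` Om) nu eta.
rewrite !nuE (_ : E2 `&` Om `&` E1 = E1 `&` E2 `&` Om); last by rewrite setIC setIA.
rewrite (_ : Om `&` E1 = E1 `&` Om); last by rewrite setIC.
apply.
- apply: sub_finite_set (finite_restr S v y); apply: image_subset; exact: edge_sub.
- exact: mfib.
- by move=> f g Of Og; rewrite !nuE; exact: move_fib.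
- move=> f g Of Og; have := move_fib setT f g measurableT _ Of Og; rewrite !setIT; apply.
  by move=> ? ?.
- by move=> f [].
- by move=> f g Of Og /rhoP fg [/(dE2 _ _ fg) ? _].
Qed.

End LeftInvariant.

(** * Cosets of the lattice *)

Section Cosets.
Variables (d : nat) (L : groupClosed (free_group d)).
Implicit Types (x y z l : free_group d) (a b : letter d).
Local Open Scope group_scope.

(** Since [xget] depends only on the set, this point depends only on the coset [L x]. *)
Definition coset_rep x : free_group d := xget 1 [set z | z * x^-1 \in L].

Lemma coset_repL x : coset_rep x * x^-1 \in L.
Proof. by rewrite /coset_rep; case: xgetP => [z _ //|/(_ x)]; rewrite /= mulgV gpred1. Qed.

Lemma coset_repE x y : x * y^-1 \in L -> coset_rep x = coset_rep y.
Proof.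
move=> xy; rewrite /coset_rep; congr xget; apply/seteqP; split=> z /= h.
  by rewrite -(mulgVK x z) -mulgA gpredM.
by rewrite -(mulgVK y z) -mulgA gpredM // -[y * _]invgK invgM invgK gpredV.
Qed.

Lemma coset_rep_inj x y : coset_rep x = coset_rep y -> x * y^-1 \in L.
Proof.
move=> e; have -> : x * y^-1 = (coset_rep x * x^-1)^-1 * (coset_rep y * y^-1).
  by rewrite e invgM invgK mulgA mulgVK.
by rewrite gpredM ?gpredV ?coset_repL.
Qed.

Lemma coset_repK x : coset_rep (coset_rep x) = coset_rep x.
Proof. by apply: coset_repE; exact: coset_repL. Qed.

Lemma coset_rep_lmul l x : l \in L -> coset_rep (l * x) = coset_rep x.
Proof. by move=> lL; apply: coset_repE; rewrite mulgK. Qed.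

Hypothesis L_index : finite_index L.

Lemma finite_reps : finite_set (range coset_rep).
Proof.
pose h (A : set (free_group d)) := xget (1 : free_group d) [set z | A z^-1].
apply: sub_finite_set (finite_image h L_index) => _ [x _ <-].
exists [set x^-1 * l | l in [set` L]]; first by exists x^-1.
rewrite /h /coset_rep; congr xget; apply/seteqP; split=> z /=.
  move=> [l lL e]; suff -> : z * x^-1 = l^-1 by rewrite gpredV.
  by rewrite -[z]invgK -e invgM invgK mulgK.
move=> zL; exists (x * z^-1); last by rewrite mulKg.
by rewrite -gpredV invgM invgK.
Qed.

Definition reps : seq (free_group d) := finmap.enum_fset (fset_set (range coset_rep)).

Lemma mem_reps x : x \in reps = (coset_rep x == x).
Proof.
apply/idP/eqP => [|e].
  by rewrite in_fset_set ?inE => [[z _ <-]|]; [exact: coset_repK|exact: finite_reps].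
by rewrite in_fset_set ?inE; [exists x|exact: finite_reps].
Qed.

Lemma uniq_reps : uniq reps.
Proof. exact: finmap.fset_uniq. Qed.

Definition cosets := seq_sub reps.

Lemma coset_subproof x : coset_rep x \in reps.
Proof. by rewrite mem_reps coset_repK. Qed.

Definition coset_of x : cosets := SeqSub (coset_subproof x).

Lemma coset_ofE x y : (coset_of x = coset_of y) <-> x * y^-1 \in L.
Proof.
split=> [/(congr1 val)/coset_rep_inj //|/coset_repE e].
by apply: val_inj.
Qed.

Lemma coset_val (c : cosets) : coset_of (val c) = c.
Proof. by apply: val_inj; case: c => x /= xr; apply/eqP; rewrite -mem_reps. Qed.

Definition cstep (c : cosets) a : cosets := coset_of (val c * gen a).

Lemma cstep_coset x a : cstep (coset_of x) a = coset_of (x * gen a).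
Proof.
by apply/coset_ofE => /=; rewrite invgM mulgA mulgK coset_repL.
Qed.

Lemma cstepK c a : cstep (cstep c a) (linv a) = c.
Proof. by rewrite -{1}(coset_val c) !cstep_coset -gen_inv mulgK coset_val. Qed.

(** A word that leads from one coset to another can be made even, if it is not, by
    going through an odd element of [L] first. *)
Lemma even_trans : ~ {subset L <= even_subgroup d} ->
  forall V : {set cosets}, V != finset.set0 ->
  (forall c a b, c \in V -> cstep (cstep c a) b \in V) -> V = [set: cosets]%SET.
Proof.
move=> nev V /set0Pn[c0 c0V] V2.
have [l lL lodd] : exists2 l, l \in L & odd (len l).
  apply: contrapT => nex; apply: nev => l lL; rewrite even_subgroupE.
  by apply/negP => lo; apply: nex; exists l.
have evenV n : forall (w : seq (letter d)) x, size w = n.*2 -> coset_of x \in V ->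
    coset_of (x * \prod_(a <- w) gen a) \in V.
  elim: n => [|n IH] [|a [|b w]] x //= sw xV; first by rewrite big_nil mulg1.
  rewrite !big_cons !mulgA; apply: IH; first by case: sw.
  by rewrite -!cstep_coset; exact: V2.
have evenW x0 x : coset_of x0 \in V -> ~~ odd (len x) -> coset_of (x0 * x) \in V.
  move=> x0V xe; rewrite -(prod_gen x); apply: (evenV (len x)./2) => //.
  by rewrite even_halfK.
apply/setP => c; rewrite finset.in_setT -(coset_val c).
have c0V' : coset_of (val c0) \in V by rewrite coset_val.
have [xe|xe] := boolP (odd (len ((val c0)^-1 * val c))).
  have -> : coset_of (val c) = coset_of (l * val c).
    by apply/coset_ofE; rewrite invgM mulgA mulgV mul1g gpredV.
  rewrite -(mulVKg (val c0) (l * val c)); apply: evenW => //.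
  by move: xe; rewrite !odd_size_mul lodd addTb addbN negbK.
by rewrite -(mulVKg (val c0) (val c)); exact: evenW.
Qed.

End Cosets.

(** * Fundamental domains *)

Section Unfolding.
Variables (d : nat) (R : realType) (eta : {measure set (borel (iso d)) -> \bar R}).
Variable (L : groupClosed (free_group d)).
Implicit Types (a b : letter d) (x y z v l : free_group d) (f g k : iso d)
  (S : seq (free_group d)) (E D : set (borel (iso d))).
Hypothesis eta_inv : forall k E, measurable E -> eta (lmul k @^-1` E) = eta E.

Definition linvariant E := forall l f, l \in L -> E f -> E (transl l * f)%g.

Lemma linvariantE E l f : linvariant E -> l \in L -> E (transl l * f)%g <-> E f.
Proof.
move=> iE lL; split; last exact: iE.
have lVL : (l^-1)%g \in L by rewrite gpredV.
by move=> /(iE _ _ lVL); rewrite mulgA -translM mulVg transl1 mul1g.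
Qed.

Lemma linvariantI E E' : linvariant E -> linvariant E' -> linvariant (E `&` E').
Proof. by move=> iE iE' l f lL [? ?]; split; [exact: iE|exact: iE']. Qed.

(** The unique element of [L] that carries [f] into the fundamental domain [D]. *)
Definition entry D f : free_group d := xget 1%g [set l | l \in L /\ D (transl l * f)%g].

Lemma entryP D f l : fundamental_domain L D ->
  entry D f = l <-> l \in L /\ D (transl l * f)%g.
Proof.
move=> /(_ f)[f' [[Df' /asboolP[l0 l0L f'E]] uf']].
have uniq l1 : l1 \in L /\ D (transl l1 * f)%g -> l1 = l0.
  move=> [l1L Dl1]; have : f' = (transl l1 * f)%g.
    by apply: uf'; split=> //; apply/asboolP; exists l1.
  rewrite f'E => /mulIg/(congr1 (fun g => iso_fun g 1%g)).
  by rewrite !iso_transl !mulg1.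
have P0 : l0 \in L /\ D (transl l0 * f)%g by rewrite -f'E.
rewrite /entry; case: xgetP => [l1 _ /= h|/(_ l0)]; last by [].
split=> [<- //|h']; by rewrite (uniq _ h) (uniq _ h').
Qed.

(** The element of [L] that carries a point of [D] into [D'] cuts [D] into countably many
    pieces, whose translates are the pieces of [D']. *)
Lemma fundamental_eq D D' E : measurable D -> measurable D' -> measurable E ->
  fundamental_domain L D -> fundamental_domain L D' -> linvariant E ->
  eta (E `&` D) = eta (E `&` D').
Proof.
move=> mD mD' mE fD fD' iE.
have mlmul l (A : set (borel (iso d))) : measurable A ->
    measurable (lmul (transl l) @^-1` A : set (borel (iso d))).
  by apply: measurable_preimage => U; exact: lmul_cont.
pose A l : set (borel (iso d)) := E `&` D `&` lmul (transl l) @^-1` D'.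
pose B l : set (borel (iso d)) := E `&` D' `&` lmul (transl l^-1%g) @^-1` D.
have mA l : measurable (A l) by apply: measurableI; [exact: measurableI|exact: mlmul].
have mB l : measurable (B l) by apply: measurableI; [exact: measurableI|exact: mlmul].
have AB l : l \in L -> eta (A l) = eta (B l).
  move=> lL; rewrite -(eta_inv (transl l) (mB l)); congr (eta _).
  have e f : lmul (transl l^-1%g) (lmul (transl l) f) = f.
    by rewrite /lmul mulgA -translM mulVg transl1 mul1g.
  apply/seteqP; split=> f.
    by move=> [[Ef Df] D'f]; split; [split=> //; exact/iE|rewrite /preimage /mkset e].
  move=> [[/linvariantE Ef D'f]]; rewrite /preimage /mkset e => Df.
  by split=> //; split=> //; exact: Ef.
have AE l : l \in L -> E `&` D `&` [set f | pickle (entry D' f) = pickle l] = A l.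
  move=> lL; apply/seteqP; split=> f [EDf h]; split=> //.
    by have /entryP -/(_ fD')[] := pcan_inj pickleK h.
  by congr pickle; apply/entryP.
have BE l : l \in L -> E `&` D' `&` [set f | pickle (entry D f)^-1%g = pickle l] = B l.
  move=> lL; apply/seteqP; split=> f [EDf h]; split=> //.
    have /(congr1 (fun x => x^-1)%g) := pcan_inj pickleK h; rewrite invgK.
    by move=> /entryP -/(_ fD)[].
  have e : entry D f = l^-1%g by apply/entryP => //; rewrite gpredV.
  by rewrite /mkset e invgK.
have Lcase n : (exists2 l, l \in L & pickle l = n) \/
    forall l, l \in L -> pickle l <> n.
  have [|h] := pselect (exists2 l, l \in L & pickle l = n); first by left.
  by right=> l lL ln; apply: h; exists l.
have entryL D1 f : fundamental_domain L D1 -> entry D1 f \in L.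
  by move=> f1; have [h _] := entryP f (entry D1 f) f1; have [] := h erefl.
have A0 n : (forall l, l \in L -> pickle l <> n) ->
    E `&` D `&` [set f | pickle (entry D' f) = n] = set0.
  by move=> h; apply/seteqP; split=> // f [_ /= fn]; exact: (h _ (entryL _ f fD') fn).
have B0 n : (forall l, l \in L -> pickle l <> n) ->
    E `&` D' `&` [set f | pickle (entry D f)^-1%g = n] = set0.
  move=> h; apply/seteqP; split=> // f [_ /= fn].
  by apply: (h _ _ fn); rewrite gpredV; exact: entryL.
rewrite (@measure_nat_partition _ (borel (iso d)) R eta (fun f => pickle (entry D' f))); last first.
  by move=> n; have [[l lL <-]|/A0 -> //] := Lcase n; rewrite AE.
rewrite (@measure_nat_partition _ (borel (iso d)) R eta
  (fun f => pickle (entry D f)^-1%g) (E `&` D')); last first.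
  by move=> n; have [[l lL <-]|/B0 -> //] := Lcase n; rewrite BE.
apply: eq_eseriesr => n _; have [[l lL <-]|h] := Lcase n.
  by rewrite AE // BE // AB.
by rewrite A0 // B0.
Qed.

Hypothesis L_index : finite_index L.

Definition vertex_dom v : set (borel (iso d)) := [set f | iso_fun f v \in reps L].

Lemma measurable_vertex_dom v : measurable (vertex_dom v).
Proof.
apply: (@measurable_determined _ [:: v]).
exact: (@determined_eval _ v [set x | x \in reps L]).
Qed.

Lemma fundamental_vertex_dom v : fundamental_domain L (vertex_dom v).
Proof.
move=> f; set x := iso_fun f v; pose l := (coset_rep L x * x^-1)%g.
have lL : l \in L by exact: coset_repL.
exists (transl l * f)%g; split.
  split; last by apply/asboolP; exists l.
  rewrite /vertex_dom /mkset iso_funM iso_transl mem_reps //.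
  by rewrite -/x /l mulgVK coset_repK.
move=> f' [D'f /asboolP[l' l'L f'E]]; rewrite f'E in D'f *; congr (transl _ * f)%g.
move: D'f; rewrite /vertex_dom /mkset iso_funM iso_transl mem_reps // -/x.
rewrite coset_rep_lmul // => /eqP e; apply: (mulIg x).
by rewrite -e /l mulgVK.
Qed.

(** The isometries that send [v] to a chosen representative of its coset form a fundamental
    domain. Being free to choose [v] is what lets the computations below follow a
    geodesic. *)
Lemma unfold_vertex v D E : measurable D -> measurable E ->
  fundamental_domain L D -> linvariant E ->
  eta (E `&` D) = (\sum_(c : cosets L) eta (E `&` pt v (val c)))%E.
Proof.
move=> mD mE fD iE.
rewrite (fundamental_eq mD (measurable_vertex_dom v) mE fD (fundamental_vertex_dom v) iE).
rewrite (@measure_seq_partition _ (borel (iso d)) R eta _ (fun f => iso_fun f v) (reps L) E).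
- rewrite -(big_map val xpredT (fun x => eta (E `&` pt v x))).
  apply: perm_big; apply: uniq_perm; rewrite ?(map_inj_uniq val_inj) ?index_enum_uniq ?uniq_reps //.
  move=> x; apply/idP/mapP => [xr|[c _ ->]]; last exact: valP.
  by exists (SeqSub xr) => //; rewrite mem_index_enum.
- exact: uniq_reps.
- by move=> x; apply: measurableI => //; exact: measurable_pt.
Qed.

Lemma unfold_edges v b D E : measurable D -> measurable E ->
  fundamental_domain L D -> linvariant E ->
  eta (E `&` D) = (\sum_(q : cosets L * letter d) eta (E `&` edge v b (val q.1) q.2))%E.
Proof.
move=> mD mE fD iE; rewrite (unfold_vertex v mD mE fD iE).
rewrite -(pair_bigA _ (fun c a => eta (E `&` edge v b (val c) a))) /=.
by apply: eq_bigr => c _; exact: pt_edges.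
Qed.

End Unfolding.

(** * Decorrelation of distant events *)

Section Decorrelation.
Variables (d : nat) (R : realType) (eta : {measure set (borel (iso d)) -> \bar R}).
Variable (L : groupClosed (free_group d)).
Implicit Types (a b : letter d) (x y z v l : free_group d) (f g k : iso d)
  (S : seq (free_group d)) (E D : set (borel (iso d))).
Hypothesis d_ge2 : (2 <= d)%N.
Hypothesis eta_inv : forall k E, measurable E -> eta (lmul k @^-1` E) = eta E.
Hypothesis eta_fin : forall x y, (eta (pt x y) < +oo)%E.
Hypothesis eta_neq0 : eta setT <> 0%E.
Hypothesis L_index : finite_index L.

Local Notation q E := (fine (eta E)).

Lemma fine_eta x y E : measurable E -> E `<=` pt x y -> eta E = (q E)%:E.
Proof. by move=> mE Exy; rewrite fineK // ge0_fin_numE // (eta_fin_sub eta_fin mE Exy). Qed.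

Lemma edge_subI v b y a E : E `&` edge v b y a `<=` pt v y.
Proof. by move=> f [_ []]. Qed.

Lemma fine_edge v b y a E : measurable E ->
  eta (E `&` edge v b y a) = (q (E `&` edge v b y a))%:E.
Proof.
move=> mE; apply: fine_eta (@edge_subI v b y a E).
by apply: measurableI => //; exact: measurable_edge.
Qed.

(** The conditional probability of [E], given that the edge from [v] along [b] is sent to
    the edge from [y] along [a]. *)
Definition cond E v b y a : R := q (E `&` edge v b y a) / q (edge v b y a).

Lemma fine_edgeT v b y a : eta (edge v b y a) = (q (edge v b y a))%:E.
Proof. exact: fine_eta (measurable_edge v b y a) (@edge_sub _ v b y a). Qed.

Lemma q_edge_gt0 v b y a : 0 < q (edge v b y a).
Proof.
by rewrite fine_gt0 // (eta_edge_gt0 eta_inv eta_neq0) (eta_edge_fin eta_fin).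
Qed.

Lemma cond_ge0 E v b y a : 0 <= cond E v b y a.
Proof. by rewrite divr_ge0 // fine_ge0. Qed.

Lemma cond_le1 E v b y a : measurable E -> cond E v b y a <= 1.
Proof.
move=> mE; rewrite ler_pdivrMr ?q_edge_gt0 // mul1r -lee_fin.
rewrite -(fine_edgeT v b y a) -(fine_edge v b y a mE); apply: le_measure; rewrite ?inE.
- by apply: measurableI => //; exact: measurable_edge.
- exact: measurable_edge.
- by move=> f [].
Qed.

Lemma cond_indep E1 E2 S v b y a : measurable E1 -> behind v b E1 ->
  determined S E2 -> (forall x, x \in S -> ahead v b x) ->
  q (E1 `&` E2 `&` edge v b y a) = cond E2 v b y a * q (E1 `&` edge v b y a).
Proof.
move=> m1 b1 d2 aS; have m2 := measurable_determined d2.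
have e : q (E1 `&` E2 `&` edge v b y a) * q (edge v b y a) =
         q (E2 `&` edge v b y a) * q (E1 `&` edge v b y a).
  apply: EFin_inj; rewrite !EFinM -(fine_edgeT v b y a) -(fine_edge v b y a m1).
  rewrite -(fine_edge v b y a m2) -(fine_edge v b y a (measurableI _ _ m1 m2)).
  exact: (edge_indep eta_inv y a m1 b1 d2 aS).
rewrite /cond mulrAC -e mulfK //.
by rewrite gt_eqF // q_edge_gt0.
Qed.

Lemma cond_linv E v b y a l : measurable E -> linvariant L E -> l \in L ->
  cond E v b (l * y)%g a = cond E v b y a.
Proof.
move=> mE iE lL; rewrite /cond (eta_edge eta_inv v b (l * y)%g a y a); congr (fine _ / _).
rewrite -(eta_inv (transl l) (E := E `&` edge v b (l * y)%g a)); last first.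
  by apply: measurableI => //; exact: measurable_edge.
congr (eta _); apply/seteqP; split=> f; rewrite /preimage /mkset /lmul.
  move=> [/(linvariantE _ iE lL) Ef [fv fvb]]; split=> //.
  rewrite /pt /mkset !iso_funM !iso_transl in fv fvb.
  by split; [exact: mulgI fv|apply: (mulgI l); rewrite fvb mulgA].
move=> [Ef [fv fvb]]; split; first exact: iE.
rewrite /edge /pt; split; rewrite /mkset iso_funM iso_transl.
  by rewrite (fv : _ = _).
by rewrite (fvb : _ = _) mulgA.
Qed.

(** The edge after the image of a given one is uniform among the [2 * d - 1] that do not turn back
    ([star_transitive]), and once it is known the past does not matter
    ([cond_indep]). *)
Lemma cond_step E S v b b' y a : determined S E -> b' != linv b ->
  (forall x, x \in S -> ahead (v * gen b)%g b' x) ->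
  cond E v b y a = (d.*2.-1%:R)^-1 *
    \sum_(a' | a' != linv a) cond E (v * gen b)%g b' (y * gen a)%g a'.
Proof.
move=> dE b'b aS; have mE := measurable_determined dE.
set v' := (v * gen b)%g; set y' := (y * gen a)%g.
have mpt := measurable_pt v y.
have split_edge F : measurable F -> q (F `&` edge v b y a) =
    \sum_(a' | a' != linv a) q (pt v y `&` F `&` edge v' b' y' a').
  move=> mF; apply: EFin_inj; rewrite -fine_edge //.
  have -> : F `&` edge v b y a = (pt v y `&` F) `&` pt v' y' by rewrite setIA [_ `&` pt v y]setIC.
  rewrite (pt_edges eta v' b' y') //; last exact: measurableI.
  rewrite (bigD1 (linv a)) //= (_ : _ `&` _ = set0) ?measure0 ?add0e.
    rewrite -sumEFin; apply: eq_bigr => a' _; rewrite fine_edge //; exact: measurableI.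
  apply/seteqP; split=> // f [[fv _] [_ fvb]]; move: b'b.
  have y'a : (y' * gen (linv a))%g = iso_fun f v by rewrite /y' -gen_inv mulgK.
  rewrite /pt /mkset y'a in fvb.
  have e : (gen b * gen b')%g = 1%g by apply: (mulgI v); rewrite mulgA mulg1; exact: iso_inj fvb.
  by have := mulg1_eq e; rewrite gen_inv => /(congr1 val)[->]; rewrite eqxx.
have bpt : behind v' b' (pt v y).
  move=> f g fg; rewrite /pt /mkset fg // aheadE /v' invgM mulgVK gen_inv.
  by rewrite [ohead _ == _]eq_sym.
have eqw a1 a2 : a1 != linv a -> a2 != linv a ->
    q (pt v y `&` edge v' b' y' a1) = q (pt v y `&` edge v' b' y' a2).
  move=> h1 h2; have [k [ky kya kyab]] := star_transitive y h1 h2.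
  rewrite -(eta_inv k (E := pt v y `&` edge v' b' y' a2)); last first.
    by apply: measurableI => //; exact: measurable_edge.
  congr (fine (eta _)); apply/seteqP; split=> f [fv [fv' fv'b]];
    split; [|split| |split]; rewrite /pt /preimage /mkset /lmul ?iso_funM in fv fv' fv'b *.
  - by rewrite fv.
  - by rewrite fv'.
  - by rewrite fv'b.
  - by apply: (@iso_inj _ k); rewrite ky.
  - by apply: (@iso_inj _ k); rewrite kya.
  - by apply: (@iso_inj _ k); rewrite kyab.
have [a0 [a0a _]] := letter_avoid d_ge2 (linv a) (linv a).
set w := q (pt v y `&` edge v' b' y' a0).
have edgeE : q (edge v b y a) = d.*2.-1%:R * w.
  rewrite -[edge v b y a]setTI split_edge // setIT (eq_bigr (fun=> w)).
    by rewrite sumr_const card_neq mulr_natl.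
  by move=> a' a'a; exact: eqw.
have D0 : d.*2.-1%:R != 0 :> R.
  by apply: contraTneq (q_edge_gt0 v b y a) => z; rewrite edgeE z mul0r ltxx.
have w0 : w != 0.
  by apply: contraTneq (q_edge_gt0 v b y a) => z; rewrite edgeE z mulr0 ltxx.
rewrite {1}/cond split_edge // edgeE invfM mulrCA; congr (_ * _).
rewrite (eq_bigr (fun a' => cond E v' b' y' a' * w)); last first.
  by move=> a' a'a; rewrite (cond_indep _ _ mpt bpt dE aS); congr (_ * _); exact: eqw.
by rewrite -mulr_suml mulfK.
Qed.

(** [L]-invariance makes the conditional probabilities functions of the cosets, so that
    [cond_step] becomes a step of the walk on a finite graph. *)
Lemma cond_iter E S v (n k0 k : nat) : measurable E -> linvariant L E -> determined S E ->
  (forall x, x \in S -> (len (x^-1 * v) <= n)%N) -> (k0 + k + n < len v)%N ->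
  forall a0, (fun q : cosets L * letter d =>
    cond E (prefix_fg k0 v) (letter_at a0 k0 v) (val q.1) q.2) =
  iter k (avg (R := R) (cstep L_index)) (fun q =>
    cond E (prefix_fg (k0 + k) v) (letter_at a0 (k0 + k) v) (val q.1) q.2).
Proof.
move=> mE iE dE Sn; elim: k => [|k IH] kn a0; first by rewrite addn0.
rewrite IH; last by lia.
rewrite iterSr; congr (iter k _ _); apply/funext => -[c a] /=.
set j := (k0 + k)%N; have jv : (j.+1 < len v)%N by rewrite /j; lia.
rewrite addnS -/j (prefixS a0) 1?ltnW // (cond_step _ _ dE (letter_at_red a0 jv)).
  rewrite /avg; congr (_ * _); apply: eq_bigr => a' _ /=.
  rewrite -[LHS](cond_linv _ _ _ _ mE iE (coset_repL L (val c * gen a)%g)).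
  by rewrite mulgVK.
move=> x /Sn xn; rewrite -prefixS; last exact: ltnW.
by apply: ahead_prefix => //; rewrite /j; lia.
Qed.

Variable D : set (borel (iso d)).
Hypotheses (mD : measurable D) (fD : fundamental_domain L D).
Hypothesis L_odd : ~ {subset L <= even_subgroup d}.

Lemma fine_unfold v b E : measurable E -> linvariant L E ->
  q (E `&` D) = \sum_(e : cosets L * letter d) q (E `&` edge v b (val e.1) e.2).
Proof.
move=> mE iE; rewrite (unfold_edges eta_inv L_index v b mD mE fD iE).
rewrite (eq_bigr (fun e : cosets L * letter d => (q (E `&` edge v b (val e.1) e.2))%:E)).
  by rewrite sumEFin.
by move=> e _; exact: fine_edge.
Qed.

(** Events that depend on what happens near [1] and near [v] decorrelate as [v]
    moves away from [1], uniformly over events near [v]: given the image of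
    the first edge of the geodesic from [1] to [v] that leaves the ball of radius
    [n], the two are independent, and the conditional probability of the second
    is obtained from a bounded function by [len v - 2 * n - 1] steps of averaging. *)
Lemma decorrelation n (e : R) : 0 < e -> exists N, forall v S1 S2 E1 E2,
  (N <= len v)%N ->
  determined S1 E1 -> (forall x, x \in S1 -> (len x <= n)%N) ->
  determined S2 E2 -> (forall x, x \in S2 -> (len (x^-1 * v) <= n)%N) ->
  linvariant L E1 -> linvariant L E2 ->
  `|q (E1 `&` E2 `&` D) * q D - q (E1 `&` D) * q (E2 `&` D)| <= e * q D ^+ 2.
Proof.
move=> e0; have [k0 k0P] :=
  avg_mixing d_ge2 (@cstepK _ _ L_index) (@even_trans _ _ L_index L_odd) e0.
exists (n + k0 + n).+1 => v S1 S2 E1 E2 vN d1 S1n d2 S2n i1 i2.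
have m1 := measurable_determined d1; have m2 := measurable_determined d2.
pose a0 : letter d := (Ordinal (ltnW d_ge2), true).
set k := (len v - (n + n).+1)%N.
have [kv k0k] : (n + k + n < len v /\ k0 <= k)%N by rewrite /k; lia.
have nv : (n < len v)%N by lia.
set vn := prefix_fg n v; set bn := letter_at a0 n v.
pose H (t : cosets L * letter d) := cond E2 vn bn (val t.1) t.2.
(* [H] is almost constant, hence close to its mean, the probability of [E2]. *)
have [lo loP] : exists lo, forall t, lo <= H t <= lo + e.
  have -> : H = _ := cond_iter m2 i2 d2 S2n kv a0; apply: k0P => // t.
  by rewrite cond_ge0 cond_le1.
set w := q (edge vn bn 1%g a0).
have wE y a : q (edge vn bn y a) = w by rewrite (eta_edge eta_inv vn bn y a 1%g a0).
have w0 : 0 < w by exact: q_edge_gt0.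
have sumT : q D = \sum_(t : cosets L * letter d) w.
  rewrite -[D in LHS]setTI (fine_unfold vn bn) //.
  by apply: eq_bigr => t _; rewrite setTI wE.
have sum1 := fine_unfold vn bn m1 i1.
have sum2 : q (E2 `&` D) = \sum_t H t * w.
  rewrite (fine_unfold vn bn) //; apply: eq_bigr => t _.
  by rewrite /H /cond wE divfK // gt_eqF.
have b1 : behind vn bn E1.
  move=> f g fg; apply: d1 => x xS; apply: fg; apply: behind_prefix => //.
  exact: S1n.
have ah2 x : x \in S2 -> ahead vn bn x.
  by move=> /S2n xn; apply: ahead_prefix => //; lia.
have sum12 : q (E1 `&` E2 `&` D) = \sum_t H t * q (E1 `&` edge vn bn (val t.1) t.2).
  rewrite (fine_unfold vn bn (measurableI _ _ m1 m2) (linvariantI i1 i2)).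
  by apply: eq_bigr => t _; exact: cond_indep m1 b1 d2 ah2.
have Yle : q (E1 `&` D) <= q D.
  rewrite sum1 sumT; apply: ler_sum => t _; rewrite -(wE (val t.1) t.2) -lee_fin.
  rewrite -(fine_edge _ _ _ _ m1) -fine_edgeT; apply: le_measure; rewrite ?inE.
  - by apply: measurableI => //; exact: measurable_edge.
  - exact: measurable_edge.
  - by move=> f [].
have Y0 : 0 <= q (E1 `&` D) by rewrite fine_ge0.
have X1 : lo * q (E1 `&` D) <= q (E1 `&` E2 `&` D).
  rewrite sum12 sum1 mulr_sumr; apply: ler_sum => t _; rewrite ler_wpM2r ?fine_ge0 //.
  by have /andP[] := loP t.
have X2 : q (E1 `&` E2 `&` D) <= (lo + e) * q (E1 `&` D).
  rewrite sum12 sum1 mulr_sumr; apply: ler_sum => t _; rewrite ler_wpM2r ?fine_ge0 //.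
  by have /andP[] := loP t.
have Z1 : lo * q D <= q (E2 `&` D).
  rewrite sum2 sumT mulr_sumr; apply: ler_sum => t _; rewrite ler_wpM2r ?(ltW w0) //.
  by have /andP[] := loP t.
have Z2 : q (E2 `&` D) <= (lo + e) * q D.
  rewrite sum2 sumT mulr_sumr; apply: ler_sum => t _; rewrite ler_wpM2r ?(ltW w0) //.
  by have /andP[] := loP t.
move: (q _) (q _) (q _) (q _) Yle Y0 X1 X2 Z1 Z2 => X W Y Z Yle Y0 X1 X2 Z1 Z2.
rewrite ler_norml; apply/andP; split; nra.
Qed.

End Decorrelation.

(** * Right translations *)

Section RightInvariance.
Variables (d : nat) (R : realType).
Implicit Types (a b : letter d) (x y z v l : free_group d) (f g k : iso d)
  (S : seq (free_group d)) (E D : set (borel (iso d))).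

Definition left_invariant (nu : {measure set (borel (iso d)) -> \bar R}) :=
  forall k E, measurable E -> nu (lmul k @^-1` E) = nu E.

Definition borel_rmul g : borel (iso d) -> borel (iso d) := rmul g.

Lemma measurable_rmul g : measurable_fun setT (borel_rmul g).
Proof. by apply: measurable_borel => U; exact: rmul_cont. Qed.

Definition right_translate (eta : {measure set (borel (iso d)) -> \bar R}) g
  : {measure set (borel (iso d)) -> \bar R}.
Proof. by refine (pushforward eta (borel_rmul g)); exact: measurable_rmul. Defined.

Lemma right_translateE eta g E : right_translate eta g E = eta (rmul g @^-1` E).
Proof. by []. Qed.

Lemma right_translate_inv eta g : left_invariant eta -> left_invariant (right_translate eta g).
Proof.
move=> inv k E mE; rewrite !right_translateE.
have mgE : measurable (rmul g @^-1` E : set (borel (iso d))).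
  by rewrite -[X in measurable X]setTI; exact: measurable_rmul.
rewrite -[RHS](inv k _ mgE); congr (eta _); apply/seteqP; split=> f;
  by rewrite /preimage /mkset /lmul /rmul mulgA.
Qed.

(** Uniqueness of Haar measure, for cylinders: the stabiliser of [y] permutes transitively
    the possible restrictions to [S] of the isometries [f] with [f x = y]. *)
Lemma left_invariant_ratio (nu nu' : {measure set (borel (iso d)) -> \bar R}) x y E S :
  left_invariant nu -> left_invariant nu' -> determined S E ->
  (nu (E `&` pt x y) * nu' (pt x y) = nu' (E `&` pt x y) * nu (pt x y))%E.
Proof.
move=> inv inv' dE; pose rho (f : borel (iso d)) := map (iso_fun f) S.
have rhoP f g : rho f = rho g <-> agree_on S f g.
  by split=> [/eq_in_map|fg]; [|exact/eq_in_map].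
have mfib w : measurable (pt x y `&` [set f | rho f = w]).
  apply: measurableI; first exact: measurable_pt.
  apply: (@measurable_determined _ S) => f g fg /=.
  by move=> <-; apply/rhoP; exact: agree_sym.
have fib m f g : left_invariant m -> pt x y f -> pt x y g ->
    m (pt x y `&` [set h | rho h = rho f]) = m (pt x y `&` [set h | rho h = rho g]).
  move=> im fx gx; rewrite -(im (g * f^-1)%g _ (mfib (rho g))); congr (m _).
  have ky : iso_fun (g * f^-1)%g y = y by rewrite iso_funM -{1}(fx : _ = y) iso_funV.
  apply/seteqP; split=> h [hx /rhoP hS].
    split; first by rewrite /pt /mkset /lmul iso_funM (hx : _ = y).
    by apply/rhoP => z zS; rewrite /lmul !iso_funM hS // iso_funV.
  split; first by apply: (@iso_inj _ (g * f^-1)%g); rewrite ky.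
  apply/rhoP => z zS; have := hS z zS; rewrite /lmul !iso_funM => /iso_inj e.
  by rewrite -(iso_funVK f (iso_fun h z)) e.
apply: (@measure_ratio _ (borel (iso d)) R _ rho (pt x y) (E `&` pt x y) nu nu') => //.
- exact: finite_restr.
- by move=> f g fx gx; exact: fib.
- by move=> f g fx gx; exact: fib.
- by move=> f g fx gx /rhoP fg [/(dE _ _ fg) ? _].
Qed.

Variables (eta : {measure set (borel (iso d)) -> \bar R}) (L : groupClosed (free_group d)).
Hypothesis eta_inv : left_invariant eta.
Hypothesis eta_fin : forall x y, (eta (pt x y) < +oo)%E.
Hypothesis eta_neq0 : eta setT <> 0%E.
Hypothesis L_index : finite_index L.
Variable D : set (borel (iso d)).
Hypotheses (mD : measurable D) (fD : fundamental_domain L D).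
Local Notation q E := (fine (eta E)).

Lemma eta_dom_fin : (eta D < +oo)%E.
Proof.
rewrite -[D]setTI (unfold_vertex eta_inv L_index 1%g mD measurableT fD) //.
by apply: lte_sum_pinfty => c _; rewrite setTI.
Qed.

Lemma eta_dom_gt0 : (0 < eta D)%E.
Proof.
rewrite -[D]setTI (unfold_vertex eta_inv L_index 1%g mD measurableT fD) //.
rewrite (bigD1 (coset_of L_index 1%g)) //= setTI.
apply: lt_le_trans (eta_pt_gt0 eta_inv eta_neq0 1%g (val (coset_of L_index 1%g))) _.
by apply: leeDl; exact: sume_ge0.
Qed.

(** Although [eta] is only left invariant, right translations preserve the mass in
    a fundamental domain of the [L]-invariant sets: they change it by a constant factor,
    and they preserve the mass of the whole space. *)
Lemma rmul_determined g E S : determined S E -> linvariant L E ->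
  q (rmul g @^-1` E `&` D) = q (E `&` D).
Proof.
move=> dE iE; set x : free_group d := 1%g.
have rpt y : rmul g @^-1` (pt x y) = pt (iso_fun g x) y by [].
have mr (F : set (borel (iso d))) : measurable F ->
    measurable (rmul g @^-1` F : set (borel (iso d))).
  by move=> mF; rewrite -[X in measurable X]setTI; exact: measurable_rmul.
have ir (F : set (borel (iso d))) : linvariant L F -> linvariant L (rmul g @^-1` F).
  by move=> iF l f lL h; rewrite /preimage /mkset /rmul -mulgA; exact: iF.
have ratio (F : set (borel (iso d))) T : determined T F -> linvariant L F ->
    (eta (F `&` D) * eta (pt (iso_fun g x) x) = eta (rmul g @^-1` F `&` D) * eta (pt x x))%E.
  move=> dF iF; have mF := measurable_determined dF.
  rewrite (unfold_vertex eta_inv L_index x mD mF fD iF).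
  rewrite (unfold_vertex eta_inv L_index (iso_fun g x) mD (mr _ mF) fD (ir _ iF)).
  rewrite !ge0_sume_distrl; try by move=> *; exact: measure_ge0.
  apply: eq_bigr => c _.
  have := left_invariant_ratio x (val c) eta_inv (right_translate_inv g eta_inv) dF.
  rewrite (eta_pt eta_inv x (val c) x).
  rewrite !right_translateE preimage_setI rpt.
  by rewrite (eta_pt eta_inv (iso_fun g x) (val c) x).
have e1 := ratio setT [::] (fun _ _ _ _ => Logic.I) (fun _ _ _ _ => Logic.I).
rewrite preimage_setT !setTI in e1.
have finpt u w : eta (pt u w) \is a fin_num by rewrite ge0_fin_numE.
have finD (F : set (borel (iso d))) : measurable F -> eta (F `&` D) \is a fin_num.
  move=> mF; rewrite ge0_fin_numE //; apply: le_lt_trans eta_dom_fin.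
  by apply: le_measure; rewrite ?inE //; exact: measurableI.
have mE := measurable_determined dE.
have D0 : q D != 0 by rewrite gt_eqF // fine_gt0 // eta_dom_gt0 eta_dom_fin.
have c0 : q (pt x x) != 0.
  by rewrite gt_eqF // fine_gt0 // (eta_pt_gt0 eta_inv eta_neq0) eta_fin.
have finD' : eta D \is a fin_num by rewrite -[D]setTI finD.
have cE : q (pt (iso_fun g x) x) = q (pt x x).
  by apply: (mulfI D0); rewrite -!fineM // e1.
have /(congr1 fine) := ratio E S dE iE; rewrite !fineM ?finD //; last exact: mr.
by rewrite cE => /(mulIf c0).
Qed.

End RightInvariance.

(** * Mixing on the quotient *)

Section HaarFacts.
Variables (d : nat) (R : realType) (eta : {measure set (borel (iso d)) -> \bar R}).
Hypothesis eta_haar : haar_measure eta.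

Lemma haar_left_invariant : left_invariant eta.
Proof.
have [_ _ inv] := eta_haar; move=> k E mE; rewrite -(inv k^-1%g E mE); congr (eta _).
apply/seteqP; split=> f; rewrite /preimage /mkset /lmul.
  by move=> Ekf; exists (k * f)%g => //; rewrite mulKg.
by move=> [h Eh <-]; rewrite mulVKg.
Qed.

Lemma haar_fin x y : (eta (pt x y) < +oo)%E.
Proof.
have [fin _ _] := eta_haar; apply: le_lt_trans (fin _ (@compact_ball d (len y + len x))).
apply: le_measure; rewrite ?inE.
- exact: measurable_pt.
- apply: (@measurable_determined _ [:: 1%g]).
  exact: (@determined_eval _ 1%g [set z | (len z <= len y + len x)%N]).
- move=> f fx; rewrite /mkset -[iso_fun f 1%g](mulVKg y).
  apply: leq_trans (size_mul_le _ _) _.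
  by rewrite -{2}(fx : _ = y) iso_len mulg1 size_inv.
Qed.

Lemma haar_neq0 : eta setT <> 0%E.
Proof. by case: eta_haar. Qed.
End HaarFacts.

Lemma mnormalize_fin disp (T : measurableType disp) (R : realType)
    (m : {measure set T -> \bar R}) P A z : m setT = z -> (0 < z)%E -> (z < +oo)%E ->
  mnormalize m P A = (m A * ((fine z)^-1)%:E)%E.
Proof. by move=> mz z0 z1; rewrite /mnormalize mz (gt_eqF z0) (lt_eqF z1). Qed.

Section Quotient.
Local Open Scope quotient_scope.
Variables (R : realType) (d : nat) (L : groupClosed (free_group d)).
Implicit Types (f g h : iso d) (A B : set (borel (iso_quot L))) (S : seq (free_group d)).

Local Notation X := (borel (iso_quot L)).
Definition act g : X -> X := @iso_act d L g.
Definition lift A : set (borel (iso d)) := @iso_pi d L @^-1` A.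

Lemma pi_surj (x : iso_quot L) : exists f, iso_pi L f = x.
Proof. by exists (repr (x : {eq_quot orbit_equiv L})); rewrite /iso_pi reprK. Qed.

Lemma lift_inj : injective lift.
Proof.
move=> A B AB; apply/seteqP; split=> x; have [f <-] := pi_surj x => h.
  by have : lift B f by rewrite -AB.
by have : lift A f by rewrite AB.
Qed.

Lemma pi_eqP f g : iso_pi L f = iso_pi L g <-> exists2 l, l \in L & g = (transl l * f)%g.
Proof.
split=> [/eqmodP /asboolP //|h]; apply/eqmodP; exact/asboolP.
Qed.

Lemma lift_linvariant A : linvariant L (lift A).
Proof.
move=> l f lL; rewrite /lift /preimage /mkset.
by have -> : iso_pi L (transl l * f)%g = iso_pi L f by apply/esym/pi_eqP; exists l.
Qed.

Lemma measurable_lift A : measurable A -> measurable (lift A).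
Proof. by apply: measurable_preimage => U. Qed.

Lemma actK g : cancel (act g) (act g^-1%g).
Proof. by move=> x; rewrite /act -iso_actM mulVg iso_act1. Qed.

Lemma act_image g A : act g @` A = act g^-1%g @^-1` A.
Proof.
apply/seteqP; split=> [_ [x Ax <-]|x Agx]; first by rewrite /preimage /mkset actK.
by exists (act g^-1%g x) => //; rewrite -[RHS](iso_act1 x) -(mulgV g) iso_actM.
Qed.

Lemma lift_act g A : lift (act g @` A) = rmul g @^-1` lift A.
Proof.
rewrite act_image; apply/seteqP; split=> f;
  by rewrite /lift /preimage /mkset /act iso_actE invgK.
Qed.

Lemma act_cont g U : open U -> open (@iso_act d L g @^-1` U).
Proof.
move=> oU; rewrite /open /= /quotient_open.
have -> : \pi_(quotient_topology _) @^-1` (@iso_act d L g @^-1` U) =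
    rmul g^-1%g @^-1` (iso_pi L @^-1` U).
  by apply/seteqP; split=> f; rewrite /preimage /mkset /rmul -iso_actE.
exact: rmul_cont.
Qed.

Lemma measurable_act g A : measurable A -> measurable (act g @` A).
Proof.
by rewrite act_image => mA; apply: measurable_preimage mA => U; exact: act_cont.
Qed.

Definition cylinder A := exists S, determined S (lift A).

Lemma cylinder_open A : cylinder A -> open (A : set (iso_quot L)).
Proof. by move=> [S dA]; exact: determined_open dA. Qed.

Lemma cylinder_measurable A : cylinder A -> measurable A.
Proof. by move=> /cylinder_open oA; exact: sub_gen_smallest. Qed.

Lemma cylinderI : setI_closed cylinder.
Proof.
move=> A B [S dA] [T dB]; exists (S ++ T); apply: determinedI.
  by apply: determined_sub dA => x xS; rewrite mem_cat xS.
by apply: determined_sub dB => x xS; rewrite mem_cat xS orbT.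
Qed.

Lemma cylinderT : cylinder setT.
Proof. by exists [::]. Qed.

Definition exhaustion n : seq (free_group d) := pmap unpickle (iota 0 n).

Lemma mem_exhaustion n x : (pickle x < n)%N -> x \in exhaustion n.
Proof.
move=> xn; rewrite mem_pmap; apply/mapP; exists (pickle x); last by rewrite pickleK.
by rewrite mem_iota.
Qed.

(** An open set is the union over [n] of the points that [exhaustion n] already
    certifies to be inside. *)
Lemma borel_cylinders : @measurable _ X = <<s cylinder >>.
Proof.
apply/seteqP; split; last first.
  by apply: smallest_sub; [exact: smallest_sigma_algebra|exact: cylinder_measurable].
apply: smallest_sub; first exact: smallest_sigma_algebra.
move=> U oU.
pose Un n : set X := [set x | exists2 f, iso_pi L f = x &
  forall g, agree_on (exhaustion n) g f -> U (iso_pi L g)].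
have -> : U = \bigcup_n Un n.
  apply/seteqP; split=> [x Ux|x [n _ [f <- fU]]]; last exact: fU.
  have [f fx] := pi_surj x.
  have /open_isoP oU' : open (lift U) by exact: oU.
  have [|S SU] := oU' f; first by rewrite /lift /preimage /mkset fx.
  exists (\max_(x <- S) pickle x).+1 => //; exists f => // g gf; apply: SU => z zS.
  apply: gf; apply: mem_exhaustion; rewrite ltnS.
  exact: leq_bigmax_seq.
have [_ _ bigU] := smallest_sigma_algebra setT cylinder; apply: bigU => n.
apply: sub_gen_smallest; exists (exhaustion n) => f g fg [h hf hU].
have /pi_eqP[l lL fE] := hf; exists (transl l^-1%g * g)%g.
  by apply/pi_eqP; exists l => //; rewrite mulgA -translM mulgV transl1 mul1g.
have lh : h = (transl l^-1%g * f)%g by rewrite fE mulgA -translM mulVg transl1 mul1g.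
move=> g' g'g; apply: hU => x xS; rewrite g'g // lh !iso_funM fg //.
Qed.

Variables (eta : {measure set (borel (iso d)) -> \bar R}) (D : set (borel (iso d))).
Hypotheses (L_index : finite_index L) (eta_haar : haar_measure eta).
Hypotheses (mD : measurable D) (fD : fundamental_domain L D).
Let mu : probability X R := haar_prob L eta mD.
Local Notation q E := (fine (eta E)).
Local Notation p A := (fine (mu A)).

Let D_fin : (eta D < +oo)%E.
Proof. exact: (eta_dom_fin (haar_left_invariant eta_haar) (haar_fin eta_haar) L_index mD fD). Qed.

Let D_gt0 : (0 < eta D)%E.
Proof. exact: (eta_dom_gt0 (haar_left_invariant eta_haar) (haar_neq0 eta_haar) L_index mD fD). Qed.

Lemma haar_probE A : mu A = (eta (lift A `&` D) * ((q D)^-1)%:E)%E.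
Proof.
have -> : mu A = mnormalize (mrestr eta mD) point (lift A) by [].
have eT : mrestr eta mD setT = eta D by rewrite /mrestr setTI.
exact: (mnormalize_fin _ _ eT D_gt0 D_fin).
Qed.

Lemma fine_haar_probE A : measurable A -> p A = q (lift A `&` D) / q D.
Proof.
move=> mA; rewrite haar_probE fineM // ge0_fin_numE //.
apply: le_lt_trans D_fin; apply: le_measure; rewrite ?inE //.
by apply: measurableI => //; exact: measurable_lift.
Qed.

Definition translated_prob g : {measure set X -> \bar R}.
Proof.
refine (pushforward mu (act g^-1%g)).
by apply: measurable_borel => U; exact: act_cont.
Defined.

Lemma haar_prob_act g A : measurable A -> mu (act g @` A) = mu A.
Proof.
have mugE B : translated_prob g B = mu (act g @` B) by rewrite act_image.
move=> mA; rewrite -mugE; apply: (measure_unique cylinder (fun=> setT)) => //.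
- exact: borel_cylinders.
- exact: cylinderI.
- by move=> _; exact: cylinderT.
- by apply/seteqP; split=> // x _; exists 0%N.
- move=> B cB; have mB := cylinder_measurable cB; have [S dB] := cB.
  rewrite mugE -[RHS](fine_prob _ mB) -(fine_prob _ (measurable_act g mB)).
  rewrite !fine_haar_probE //; last exact: measurable_act.
  rewrite lift_act (rmul_determined (haar_left_invariant eta_haar) (haar_fin eta_haar)
    (haar_neq0 eta_haar) L_index mD fD g dB (@lift_linvariant B)) //.
- move=> _; rewrite mugE; apply: le_lt_trans (probability_le1 _ _) (ltry 1) => //.
  exact: measurable_act.
Qed.

Definition corr g A B := p (act g @` A `&` B).

Lemma actU g A B : act g @` (A `|` B) = act g @` A `|` act g @` B.
Proof. exact: image_setU. Qed.

Lemma actI0 g A B : A `&` B = set0 -> act g @` A `&` act g @` B = set0.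
Proof. by rewrite !act_image -preimage_setI => ->; rewrite preimage_set0. Qed.

Lemma corr_additivel g B : measurable B -> fin_additive (fun A => corr g A B).
Proof.
move=> mB A A' mA mA' AA'; rewrite /corr actU setIUl fine_probU //.
- by apply: measurableI => //; exact: measurable_act.
- by apply: measurableI => //; exact: measurable_act.
- by rewrite setIACA (actI0 g AA') set0I.
Qed.

Lemma corr_additiver g A : measurable A -> fin_additive (corr g A).
Proof.
move=> mA B B' mB mB' BB'; rewrite /corr setIUr fine_probU //.
- by apply: measurableI => //; exact: measurable_act.
- by apply: measurableI => //; exact: measurable_act.
- by rewrite setIACA BB' setI0.
Qed.

Lemma corr_dominatedl g B : measurable B -> dominated mu (fun A => corr g A B).
Proof.
move=> mB A mA; rewrite fine_prob_ge0 -[in leRHS](haar_prob_act g mA) /=; apply: fine_prob_le.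
- by apply: measurableI => //; exact: measurable_act.
- exact: measurable_act.
- by move=> x [].
Qed.

Lemma corr_dominatedr g A : measurable A -> dominated mu (corr g A).
Proof.
move=> mA B mB; rewrite fine_prob_ge0 /=; apply: fine_prob_le => //.
by apply: measurableI => //; exact: measurable_act.
Qed.

(** Continuity in [g], because nearby isometries translate a cylinder to the same set. *)
Lemma corr_cvg g A B (e : R) : measurable A -> measurable B -> 0 < e ->
  nbhs g [set g' | `|corr g' A B - corr g A B| <= e].
Proof.
move=> mA mB e0.
apply: (@dominated_set_cvg _ X R mu _ (nbhs g) _ cylinder (fun g A => corr g A B)
  (fun A => corr g A B)) => //.
- exact: borel_cylinders.
- exact: cylinderI.
- exact: cylinderT.
- by move=> h; exact: corr_additivel.
- exact: corr_additivel.
- by move=> h; exact: corr_dominatedl.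
- exact: corr_dominatedl.
move=> C [S dC] e' e'0; apply: filterS (nbhs_agree S g) => h hg /=.
rewrite /corr; have -> : act h @` C = act g @` C; last by rewrite subrr normr0 ltW.
apply: lift_inj; rewrite !lift_act; apply/seteqP; split=> f; apply: dC => y yS.
  by rewrite /rmul !iso_funM hg.
by rewrite /rmul !iso_funM hg.
Qed.

(** The complements of the compact sets of [compact_ball] are a base of it. *)
Definition at_infinity : set_system (iso d) :=
  [set U | exists N, forall g, (N <= len (iso_fun g 1))%N -> U g].

Lemma at_infinity_filter : Filter at_infinity.
Proof.
split; first by exists 0%N.
- move=> U V [N NU] [M MV]; exists (maxn N M) => g; rewrite geq_max => /andP[? ?].
  by split; [exact: NU|exact: MV].
- by move=> U V UV [N NU]; exists N => g /NU; exact: UV.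
Qed.

Hypothesis d_ge2 : (2 <= d)%N.
Hypothesis L_odd : ~ {subset L <= even_subgroup d}.

(** If [A] is determined by [S], its translate by [g] is determined by the image of [S],
    which stays within a fixed distance of [g 1]. *)
Lemma corr_vanish_cylinders A B (e : R) : cylinder A -> cylinder B -> 0 < e ->
  at_infinity [set g | `|corr g A B - p A * p B| <= e].
Proof.
move=> cA cB e0; have [S dA] := cA; have [T dB] := cB.
have mA := cylinder_measurable cA; have mB := cylinder_measurable cB.
pose n := \max_(x <- S ++ T) len x.
have [N NP] := decorrelation d_ge2 (haar_left_invariant eta_haar) (haar_fin eta_haar)
  (haar_neq0 eta_haar) L_index mD fD L_odd n e0.
exists N => g gN /=.
have dgA : determined (map (iso_fun g) S) (lift (act g @` A)).
  move=> f h fh; rewrite lift_act; apply: dA => x xS.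
  by rewrite /rmul !iso_funM fh // map_f.
have := NP (iso_fun g 1%g) T (map (iso_fun g) S) (lift B) (lift (act g @` A)) gN dB _ dgA.
have nT x : x \in T -> (len x <= n)%N.
  by move=> xT; apply: leq_bigmax_seq; rewrite ?mem_cat ?xT ?orbT.
have nS x : x \in map (iso_fun g) S -> (len (x^-1 * iso_fun g 1) <= n)%N.
  move=> /mapP[y yS ->]; rewrite iso_len mulg1 size_inv.
  by apply: leq_bigmax_seq; rewrite ?mem_cat ?yS.
move=> /(_ nT nS (@lift_linvariant _) (@lift_linvariant _)).
have -> : lift B `&` lift (act g @` A) `&` D = lift (act g @` A `&` B) `&` D.
  by rewrite [lift B `&` _]setIC.
have qD : 0 < q D by rewrite fine_gt0 // D_gt0 D_fin.
have qE C : measurable C -> q (lift C `&` D) = p C * q D.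
  by move=> mC; rewrite fine_haar_probE // divfK // gt_eqF.
have mgA := measurable_act g mA.
rewrite !qE //; last exact: measurableI.
have -> : p (act g @` A) = p A by rewrite haar_prob_act.
have -> : p (act g @` A `&` B) * q D * q D - p B * q D * (p A * q D) =
    (corr g A B - p A * p B) * q D ^+ 2 by rewrite /corr; lra.
rewrite normrM [`|q D ^+ 2|]ger0_norm ?exprn_ge0 ?(ltW qD) // ler_pM2r //.
by rewrite exprn_gt0.
Qed.

(** The Dynkin argument is applied to the first set, then to the second. *)
Lemma corr_vanish A B (e : R) : measurable A -> measurable B -> 0 < e ->
  at_infinity [set g | `|corr g A B - p A * p B| <= e].
Proof.
have FF := at_infinity_filter.
have p01 C : measurable C -> 0 <= p C <= 1.
  by move=> mC; rewrite fine_prob_ge0 -(fine_probT mu) fine_prob_le.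
have addp (t : R) : fin_additive (fun C => p C * t).
  by move=> C C' mC mC' CC'; rewrite fine_probU // mulrDl.
have domp (t : R) : 0 <= t <= 1 -> dominated mu (fun C => p C * t).
  by move=> /andP[t0 t1] C mC; rewrite mulr_ge0 ?fine_prob_ge0 //= ler_piMr ?fine_prob_ge0.
have half C (e' : R) : cylinder C -> 0 < e' -> forall A', measurable A' ->
    at_infinity [set g | `|corr g A' C - p A' * p C| <= e'].
  move=> cC e'0 A' mA'; have mC := cylinder_measurable cC.
  apply: (@dominated_set_cvg _ X R mu _ _ FF cylinder (fun g A => corr g A C)
    (fun A => p A * p C)) => //.
  - exact: borel_cylinders.
  - exact: cylinderI.
  - exact: cylinderT.
  - by move=> h; exact: corr_additivel.
  - by move=> h; exact: corr_dominatedl.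
  - exact: domp (p01 _ mC).
  - by move=> A1 cA1 e1 e10; exact: corr_vanish_cylinders.
move=> mA mB e0.
apply: (@dominated_set_cvg _ X R mu _ _ FF cylinder (fun g B => corr g A B)
  (fun B => p A * p B)) => //.
- exact: borel_cylinders.
- exact: cylinderI.
- exact: cylinderT.
- by move=> h; exact: corr_additiver.
- by move=> C C' mC mC' CC'; rewrite fine_probU // mulrDr.
- by move=> h; exact: corr_dominatedr.
- by move=> C mC; rewrite mulrC; exact: domp (p01 _ mA) _ mC.
- by move=> C cC e1 e10; exact: half.
Qed.

Lemma iso_mixing : mixing act mu.
Proof.
move=> A B mA mB e e0.
have mgA g : measurable (act g @` A `&` B) by apply: measurableI => //; exact: measurable_act.
have corrE g : (e%:E <= `|mu (act g @` A `&` B) - mu A * mu B|)%E =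
    (e <= `|corr g A B - p A * p B|).
  have [eA eB eAB] := And3 (fine_prob mu mA) (fine_prob mu mB) (fine_prob mu (mgA g)).
  by rewrite -eA -eB -eAB -EFinM -EFinB abse_EFin lee_fin.
rewrite (_ : mkset _ = [set g | e <= `|corr g A B - p A * p B|]); last first.
  by apply/funext => g; rewrite /mkset; congr is_true; exact: corrE.
have e20 : 0 < e / 2 by lra.
have [N NP] := corr_vanish mA mB e20.
apply: (subclosed_compact _ (@compact_ball d N)).
  rewrite -openC openE => g /negP; rewrite -ltNge => ge.
  set t := `|corr g A B - p A * p B| in ge.
  have t0 : 0 < (e - t) / 2 by lra.
  apply: filterS (corr_cvg g mA mB t0) => h hg /=; apply/negP; rewrite -ltNge.
  rewrite -[corr h A B - _](subrKA (corr g A B)).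
  have {}hg : `|corr h A B - corr g A B| <= (e - t) / 2 := hg.
  apply: le_lt_trans (ler_normD _ _) _; rewrite -/t; lra.
move=> g /= ge; rewrite leqNgt; apply/negP => /ltnW /NP /=; lra.
Qed.

Lemma fg_mixing : mixing act mu -> mixing (fun x : free_group d => act (transl x)) mu.
Proof.
move=> mix A B mA mB e e0.
have [N NP] := compact_iso_bounded (mix A B mA mB e e0).
apply: finite_compact; apply: sub_finite_set (finite_ball d N) => x xe.
by have := NP (transl x) xe; rewrite iso_transl mulg1.
Qed.

Definition even_part : set X := [set x | exists2 f, iso_pi L f = x & ~~ odd (len (iso_fun f 1))].

Section EvenLattice.
Hypothesis L_even : {subset L <= even_subgroup d}.

Lemma lift_even_part : lift even_part = [set f | ~~ odd (len (iso_fun f 1%g))].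
Proof.
apply/seteqP; split=> f; last by move=> fe; exists f.
move=> [h /pi_eqP[l lL ->]] he; rewrite /mkset iso_funM iso_transl odd_size_mul.
by have := L_even lL; rewrite even_subgroupE => /negbTE ->.
Qed.

Lemma even_part_cylinder : cylinder even_part.
Proof.
exists [:: 1%g]; rewrite lift_even_part.
exact: (@determined_eval _ 1%g [set z | ~~ odd (len z)]).
Qed.

Lemma even_part_act x : act (transl x) @` even_part =
  if odd (len x) then ~` even_part else even_part.
Proof.
have par f : odd (len (iso_fun f x)) = odd (len (iso_fun f 1%g)) (+) odd (len x).
  by rewrite -[iso_fun f x](mulVKg (iso_fun f 1%g)) odd_size_mul iso_len invg1 mul1g.
have key f : ~~ odd (len (iso_fun (f * transl x)%g 1%g)) =
    ~~ (odd (len (iso_fun f 1%g)) (+) odd (len x)).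
  by rewrite iso_funM iso_transl mulg1 par.
apply: lift_inj; rewrite lift_act; case: ifP => xo.
  have -> : lift (~` even_part) = ~` lift even_part by [].
  rewrite lift_even_part; apply/funext => f.
  by rewrite /preimage /mkset /rmul key xo addbT /setC /mkset; apply/propext; split=> /negP.
rewrite lift_even_part; apply/funext => f.
by rewrite /preimage /mkset /rmul key xo addbF.
Qed.

Lemma not_mixing_even : ~ mixing (fun x : free_group d => act (transl x)) mu.
Proof.
move=> mix; have cA := even_part_cylinder; have mA := cylinder_measurable cA.
pose a0 : letter d := (Ordinal (ltnW d_ge2), true).
(* A generator exchanges [even_part] with its complement. *)
have pA : p even_part = 1 / 2.
  have := haar_prob_act (transl (gen a0)) mA; rewrite even_part_act /= => /(congr1 fine) e.
  have := fine_probU mu mA (measurableC mA) (setICr _); rewrite setUCr fine_probT e.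
  lra.
have e40 : 0 < 1 / 4 :> R by lra.
have [N NP] := compact_fg_bounded (mix _ _ mA mA _ e40).
have rx : reduced (nseq N.+1.*2 a0).
  elim: N.+1.*2 => [//|[//|k] IH].
  by apply/andP; split; [rewrite eq_sym linv_neq|exact: IH].
(* A long word of even length preserves [even_part], and 1 / 2 differs from 1 / 4. *)
have lx : len (FreeGroup rx) = N.+1.*2 by rewrite /= size_nseq.
have : (len (FreeGroup rx) <= N)%N.
  apply: NP; rewrite /mkset even_part_act lx odd_double setIid.
  have eA := fine_prob mu mA; rewrite -[mu even_part](eA) pA -EFinM -EFinB abse_EFin lee_fin.
  by rewrite ger0_norm; lra.
by rewrite lx -addnn addSn; lia.
Qed.
End EvenLattice.

End Quotient.

Theorem theorem5p7 (R : realType) (d : nat) (d_ge2 : (2 <= d)%N)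
    (L : groupClosed (free_group d)) (L_index : finite_index L)
    (eta : {measure set (borel (iso d)) -> \bar R})
    (eta_haar : haar_measure eta)
    (D : set (borel (iso d))) (mD : measurable D)
    (D_fund : fundamental_domain L D) :
  [<-> mixing (@iso_act d L : iso d -> borel (iso_quot L) -> borel (iso_quot L))
         (haar_prob L eta mD);
       mixing (@fg_act d L : free_group d -> borel (iso_quot L) -> borel (iso_quot L))
         (haar_prob L eta mD);
       ~ {subset L <= even_subgroup d} ].
Proof.
tfae.
- exact: fg_mixing.
- move=> mix L_even; exact: (not_mixing_even L_index eta_haar D_fund d_ge2 L_even mix).
- move=> L_odd; exact: (iso_mixing L_index eta_haar D_fund d_ge2 L_odd).
Qed.
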